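(* Let $p$ be a prime number, let $k$ be an algebraically closed field of characteristic $p$, and let $n$ be a positive integer. Then $\operatorname{ed}(\operatorname{Dec}_{p,n})\leq n+1$.
   Context: For a field $F$ of characteristic $p$, $\alpha\in F$ and $\beta\in F^\times$, $[\alpha,\beta)_{p,F}$ denotes the cyclic $F$-algebra of degree $p$ generated by $i,j$ subject to $i^p-i=\alpha$, $j^p=\beta$, $jij^{-1}=i+1$. A cyclic algebra of degree $p$ over $F$ is an algebra of this form. $\operatorname{Dec}_{p,n}$ is the functor sending each field $F\supseteq k$ to the set of isomorphism classes of central simple $F$-algebras of degree $p^n$ that decompose as tensor products over $F$ of $n$ cyclic algebras of degree $p$ over $F$; the maps are given by scalar extension. For a covariant functor $\mathcal F$ from fields containing $k$ to sets and $A\in\mathcal F(F)$, $\operatorname{ed}(A)$ is the minimal $d$ for which there exist a field $E$ with $k\subseteq E\subseteq F$, $\operatorname{tr.deg}(E/k)=d$, and $B\in\mathcal F(E)$ with $B_F=A$. $\operatorname{ed}(\mathcal F)$ is the supremum of $\operatorname{ed}(A)$ over all fields $F\supseteq k$ and all $A\in\mathcal F(F)$. *)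

(* Defs.v *)
From HB Require Import structures.
From mathcomp Require Import all_boot all_order all_algebra all_field.
From mathcomp Require Import mpoly.
From Stdlib Require Import Classical.

Set Implicit Arguments.
Unset Strict Implicit.
Unset Printing Implicit Defensive.

Import GRing.Theory.
Local Open Scope ring_scope.

Section Coordinates.
Variables (E : fieldType) (A : falgType E).

Definition abasis (l : 'I_(\dim {:A})) : A := (vbasis {:A})`_l.
Definition acoord (l : 'I_(\dim {:A})) (a : A) : E := coord (vbasis {:A}) l a.

Lemma acoord_sum a : a = \sum_l acoord l a *: abasis l.
Proof. exact: coord_vbasis (memvf a). Qed.

Lemma acoordD l : {morph acoord l : x y / x + y}.
Proof. exact: raddfD. Qed.

Lemma acoordZ l c x : acoord l (c *: x) = c * acoord l x.
Proof. by rewrite /acoord linearZ. Qed.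

Lemma acoord_basis i l : acoord l (abasis i) = (i == l)%:R.
Proof.
by rewrite /acoord /abasis coord_free ?(basis_free (vbasisP _)) // eq_sym.
Qed.
End Coordinates.

(* For a field morphism f : E -> F, an E-algebra A and an F-algebra B,
   stensor f A B is the F-algebra A (x)_E B.  It is built on B^(dim A): with
   (e_l) the E-basis vbasis {:A}, the family (u_l) stands for
   \sum_l e_l (x) u_l.                                                       *)
Definition stensor (E F : fieldType) (f : {rmorphism E -> F})
    (A : falgType E) (B : falgType F) : Type :=
  {ffun 'I_(\dim {:A}) -> B}.

HB.instance Definition _ (E F : fieldType) (f : {rmorphism E -> F})
    (A : falgType E) (B : falgType F) :=
  Vector.copy (stensor f A B) {ffun 'I_(\dim {:A}) -> B}.

Section Tensor.
Variables (E F : fieldType) (f : {rmorphism E -> F}).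
Variables (A : falgType E) (B : falgType F).
Local Notation T := (stensor f A B).

Definition tcomp (u : T) : {ffun 'I_(\dim {:A}) -> B} := u.
Definition tens (a : A) (b : B) : T := [ffun l => f (acoord l a) *: b].
Definition tens_one : T := tens 1 1.
Definition tens_mul (u v : T) : T :=
  \sum_i \sum_j tens (abasis i * abasis j) (tcomp u i * tcomp v j).

Lemma tcompD u v l : tcomp (u + v) l = tcomp u l + tcomp v l.
Proof. exact: ffunE. Qed.

Lemma tcomp0 l : tcomp 0 l = 0.
Proof. exact: ffunE. Qed.

Lemma tcompZ c u l : tcomp (c *: u) l = c *: tcomp u l.
Proof. exact: ffunE. Qed.

Lemma tcomp_tens a b l : tcomp (tens a b) l = f (acoord l a) *: b.
Proof. exact: ffunE. Qed.

Lemma tcompP (u v : T) : (forall l, tcomp u l = tcomp v l) -> u = v.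
Proof. by move=> uv; apply/ffunP. Qed.

Lemma tensDl b : {morph tens^~ b : a a' / a + a'}.
Proof.
move=> a a'; apply: tcompP => l.
by rewrite tcompD !tcomp_tens acoordD rmorphD scalerDl.
Qed.

Lemma tensDr a : {morph tens a : b b' / b + b'}.
Proof.
by move=> b b'; apply: tcompP => l; rewrite tcompD !tcomp_tens scalerDr.
Qed.

Lemma tensZr a c b : tens a (c *: b) = c *: tens a b.
Proof.
by apply: tcompP => l; rewrite tcompZ !tcomp_tens !scalerA mulrC.
Qed.

Lemma tensZl c a b : tens (c *: a) b = f c *: tens a b.
Proof.
by apply: tcompP => l; rewrite tcompZ !tcomp_tens acoordZ rmorphM scalerA.
Qed.

Lemma tens0l b : tens 0 b = 0.
Proof. by rewrite -(scale0r (0 : A)) tensZl rmorph0 scale0r. Qed.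

Lemma tens0r a : tens a 0 = 0.
Proof. by rewrite -(scale0r (0 : B)) tensZr scale0r. Qed.

Lemma tens_suml I (r : seq I) (x : I -> A) b :
  tens (\sum_(i <- r) x i) b = \sum_(i <- r) tens (x i) b.
Proof. by rewrite (big_morph _ (tensDl b) (tens0l b)). Qed.

Lemma tens_sumr I (r : seq I) a (x : I -> B) :
  tens a (\sum_(i <- r) x i) = \sum_(i <- r) tens a (x i).
Proof. by rewrite (big_morph _ (tensDr a) (tens0r a)). Qed.

Lemma tens_decomp (u : T) : u = \sum_l tens (abasis l) (tcomp u l).
Proof.
have tcs l (x : 'I_(\dim {:A}) -> T) :
    tcomp (\sum_i x i) l = \sum_i tcomp (x i) l.
  by rewrite (big_morph (fun w => tcomp w l) (fun v w => tcompD v w l) (tcomp0 l)).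
apply: tcompP => l; rewrite tcs (bigD1 l) //= tcomp_tens acoord_basis eqxx.
rewrite rmorph1 scale1r big1 ?addr0 // => i /negPf il.
by rewrite tcomp_tens acoord_basis il rmorph0 scale0r.
Qed.

Lemma tens_ind (P : T -> Prop) :
    (forall u v, P u -> P v -> P (u + v)) -> (forall a b, P (tens a b)) ->
  forall u, P u.
Proof.
move=> PD Pt u; rewrite (tens_decomp u).
elim/big_ind: _ => //; rewrite -(tens0l 0); exact: Pt.
Qed.

Fact tens_mulDl : left_distributive tens_mul +%R.
Proof.
move=> u v w; rewrite /tens_mul -big_split; apply: eq_bigr => i _ /=.
rewrite -big_split; apply: eq_bigr => j _ /=.
by rewrite tcompD mulrDl tensDr.
Qed.

Fact tens_mulDr : right_distributive tens_mul +%R.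
Proof.
move=> w u v; rewrite /tens_mul -big_split; apply: eq_bigr => i _ /=.
rewrite -big_split; apply: eq_bigr => j _ /=.
by rewrite tcompD mulrDr tensDr.
Qed.

Fact tens_mulAl c u v : c *: tens_mul u v = tens_mul (c *: u) v.
Proof.
rewrite /tens_mul scaler_sumr; apply: eq_bigr => i _.
rewrite scaler_sumr; apply: eq_bigr => j _.
by rewrite tcompZ -scalerAl tensZr.
Qed.

Fact tens_mulAr c u v : c *: tens_mul u v = tens_mul u (c *: v).
Proof.
rewrite /tens_mul scaler_sumr; apply: eq_bigr => i _.
rewrite scaler_sumr; apply: eq_bigr => j _.
by rewrite tcompZ -scalerAr tensZr.
Qed.

Fact tens_mulE a b a' b' :
  tens_mul (tens a b) (tens a' b') = tens (a * a') (b * b').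
Proof.
rewrite [in RHS](acoord_sum a) mulr_suml tens_suml /tens_mul.
apply: eq_bigr => i _; rewrite [in RHS](acoord_sum a') mulr_sumr tens_suml.
apply: eq_bigr => j _; rewrite !tcomp_tens -scalerAl -scalerAr !tensZr.
by rewrite -scalerAl -scalerAr !tensZl.
Qed.

Fact tens_mulA : associative tens_mul.
Proof.
move=> u v w; move: u; apply: tens_ind => [u u' Hu Hu'|a b].
  by rewrite !tens_mulDl Hu Hu'.
move: v; apply: tens_ind => [v v' Hv Hv'|a' b'].
  by rewrite tens_mulDl !tens_mulDr tens_mulDl Hv Hv'.
move: w; apply: tens_ind => [w w' Hw Hw'|a'' b''].
  by rewrite !tens_mulDr Hw Hw'.
by rewrite !tens_mulE !mulrA.
Qed.

Fact tens_mul1l : left_id tens_one tens_mul.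
Proof.
apply: tens_ind => [u v Hu Hv|a b]; first by rewrite tens_mulDr Hu Hv.
by rewrite tens_mulE !mul1r.
Qed.

Fact tens_mul1r : right_id tens_one tens_mul.
Proof.
apply: tens_ind => [u v Hu Hv|a b]; first by rewrite tens_mulDl Hu Hv.
by rewrite tens_mulE !mulr1.
Qed.

Fact tens_one_neq0 : tens_one != 0.
Proof.
apply/eqP=> one0; have /eqP[] := oner_neq0 A; rewrite (acoord_sum 1) big1 // => l _.
have := congr1 (fun w => tcomp w l) one0; rewrite tcomp_tens tcomp0.
move/eqP; rewrite scaler_eq0 oner_eq0 orbF fmorph_eq0 => /eqP->.
by rewrite scale0r.
Qed.

HB.instance Definition _ := GRing.Zmodule_isNzRing.Build T
  tens_mulA tens_mul1l tens_mul1r tens_mulDl tens_mulDr tens_one_neq0.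
HB.instance Definition _ := GRing.Lmodule_isLalgebra.Build F T tens_mulAl.
HB.instance Definition _ := GRing.Lalgebra_isAlgebra.Build F T tens_mulAr.
HB.instance Definition _ := Algebra_isFalgebra.Build F T.

Lemma tensM a b a' b' : tens a b * tens a' b' = tens (a * a') (b * b').
Proof. exact: tens_mulE. Qed.

Lemma tens1 : tens 1 1 = 1. Proof. by []. Qed.

Lemma dim_stensor : \dim {:T} = (\dim {:A} * \dim {:B})%N.
Proof. by rewrite !(dimvf B) (dimvf T) /dim /= card_ord. Qed.
End Tensor.

Definition tensor (F : fieldType) (A B : falgType F) : falgType F :=
  stensor idfun A B.

Definition scalar_ext (E F : fieldType) (f : {rmorphism E -> F})
  (A : falgType E) : falgType F := stensor f A F^o.

Definition alg_iso (F : fieldType) (A B : falgType F) : Prop :=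
  exists phi : {lrmorphism A -> B}, bijective phi.

Section Isomorphisms.
Variable F : fieldType.
Implicit Types A B C D : falgType F.

Lemma alg_isoI A B (phi : A -> B) :
    linear phi -> phi 1 = 1 -> {morph phi : x y / x * y} -> bijective phi ->
  alg_iso A B.
Proof.
move=> lin phi1 phiM bij.
pose phiL := GRing.isLinear.Build F A B _ phi lin.
pose phiR := GRing.isMonoidMorphism.Build A B phi (phi1, phiM).
pose psi : {lrmorphism A -> B} := HB.pack phi phiL phiR.
by exists psi.
Qed.

Lemma alg_iso_surj A B (phi : A -> B) :
    linear phi -> phi 1 = 1 -> {morph phi : x y / x * y} ->
    \dim {:A} = \dim {:B} -> (forall b, exists a, phi a = b) ->
  alg_iso A B.
Proof.
move=> lin phi1 phiM dimAB surj; apply: (alg_isoI lin) => //.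
pose phiL : {linear A -> B} := HB.pack phi (GRing.isLinear.Build F A B _ phi lin).
pose g := linfun phiL.
have gE x : g x = phi x by rewrite lfunE.
have imgg : limg g = fullv.
  apply/eqP; rewrite eqEsubv subvf /=; apply/subvP=> b _.
  by have [a <-] := surj b; rewrite -gE memv_img ?memvf.
have kerg : lker g == 0%VS.
  have := limg_ker_dim g fullv; rewrite imgg capfv dimAB.
  by move/(canRL (addnK _)); rewrite subnn => /eqP; rewrite dimv_eq0.
have phiK x : (g^-1)%VF (phi x) = x by rewrite -gE; exact: lker0_lfunK.
exists (g^-1)%VF => // y; have [a <-] := surj y.
by rewrite phiK.
Qed.

Lemma alg_iso_refl A : alg_iso A A.
Proof. by exists idfun; exists idfun. Qed.

Lemma alg_iso_sym A B : alg_iso A B -> alg_iso B A.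
Proof.
case=> phi [psi phiK psiK]; apply: (@alg_isoI B A psi).
- by move=> c x y; apply: (can_inj phiK); rewrite psiK linearP /= !psiK.
- by apply: (can_inj phiK); rewrite rmorph1 psiK.
- by move=> x y; apply: (can_inj phiK); rewrite psiK rmorphM /= !psiK.
- by exists phi.
Qed.

Lemma alg_iso_trans B A C : alg_iso A B -> alg_iso B C -> alg_iso A C.
Proof.
by case=> phi bphi [psi bpsi]; exists (psi \o phi); apply: bij_comp.
Qed.

Lemma alg_iso_dim A B : alg_iso A B -> \dim {:A} = \dim {:B}.
Proof.
case=> phi [psi phiK psiK]; pose g := linfun phi.
have kerg : lker g == 0%VS by apply/lker0P=> x y; rewrite !lfunE => /(can_inj phiK).
rewrite -(limg_dim_eq (f := g) (U := fullv)) ?(eqP kerg) ?capv0 //.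
congr (\dim _); apply/eqP; rewrite eqEsubv subvf /=; apply/subvP=> b _.
by rewrite -(psiK b) -[phi _](lfunE phi) memv_img ?memvf.
Qed.
End Isomorphisms.

Section Universal.
Variables (E F : fieldType) (f : {rmorphism E -> F}).
Variables (A : falgType E) (B C : falgType F).
Variables (g : {rmorphism A -> C}) (h : {lrmorphism B -> C}).
Hypothesis gZ : forall c a, g (c *: a) = f c *: g a.
Hypothesis ghC : forall a b, g a * h b = h b * g a.

Definition tens_univ (u : stensor f A B) : C :=
  \sum_l g (abasis l) * h (tcomp u l).

Lemma tens_univE a b : tens_univ (tens f a b) = g a * h b.
Proof.
rewrite [in RHS](acoord_sum a) rmorph_sum mulr_suml; apply: eq_bigr => l _.
rewrite tcomp_tens linearZ /= gZ -scalerAl -scalerAr.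
by congr (_ *: (_ * _)).
Qed.

Lemma tens_univ_linear : linear tens_univ.
Proof.
move=> c u v; rewrite /tens_univ scaler_sumr -big_split; apply: eq_bigr => l _.
by rewrite tcompD tcompZ linearP /= mulrDr -scalerAr.
Qed.

Lemma tens_univ1 : tens_univ 1 = 1.
Proof. by rewrite -tens1 tens_univE !rmorph1 mulr1. Qed.

Lemma tens_univD : {morph tens_univ : u v / u + v}.
Proof. by move=> u v; have := tens_univ_linear 1 u v; rewrite !scale1r. Qed.

Lemma tens_univM : {morph tens_univ : u v / u * v}.
Proof.
move=> u v; move: u; apply: tens_ind => [u u' Hu Hu'|a b].
  by rewrite !(mulrDl, tens_univD) Hu Hu'.
move: v; apply: tens_ind => [v v' Hv Hv'|a' b'].
  by rewrite !(mulrDr, tens_univD) Hv Hv'.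
rewrite tensM !tens_univE !rmorphM -!mulrA; congr (_ * _).
by rewrite !mulrA ghC.
Qed.

Lemma tens_univ_iso :
    \dim {:C} = (\dim {:A} * \dim {:B})%N ->
    (forall P : C -> Prop, (forall x y, P x -> P y -> P (x + y)) ->
       (forall a b, P (g a * h b)) -> forall c, P c) ->
  alg_iso (stensor f A B) C.
Proof.
move=> dimC indC; apply: (alg_iso_surj tens_univ_linear) => //.
- exact: tens_univ1.
- exact: tens_univM.
- by rewrite dim_stensor dimC.
apply: indC => [x y [u <-] [v <-]|a b].
  by exists (u + v); rewrite tens_univD.
by exists (tens f a b); rewrite tens_univE.
Qed.
End Universal.

Section ScalarExtension.
Variables (E F : fieldType) (f : {rmorphism E -> F}).
Implicit Types A B : falgType E.

Definition ext_in A (a : A) : scalar_ext f A := tens f a (1 : F^o).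

Section Morphism.
Variable A : falgType E.

Fact ext_in_zmod : zmod_morphism (@ext_in A).
Proof.
by move=> a b; rewrite /ext_in tensDl -scaleN1r tensZl rmorphN1 scaleN1r.
Qed.

Fact ext_in_monoid : monoid_morphism (@ext_in A).
Proof. by split=> [|a b]; rewrite /ext_in ?tens1 // tensM mulr1. Qed.

HB.instance Definition _ :=
  GRing.isZmodMorphism.Build A (scalar_ext f A) (@ext_in A) ext_in_zmod.
HB.instance Definition _ :=
  GRing.isMonoidMorphism.Build A (scalar_ext f A) (@ext_in A) ext_in_monoid.

Lemma ext_inZ c (a : A) : ext_in (c *: a) = f c *: ext_in a.
Proof. exact: tensZl. Qed.

Lemma tens_ext_in (a : A) (x : F^o) : tens f a x = x *: ext_in a.
Proof. by rewrite /ext_in -tensZr [_ *: _]mulr1. Qed.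

Lemma scalar_ext_ind (P : scalar_ext f A -> Prop) :
    (forall u v, P u -> P v -> P (u + v)) ->
    (forall x a, P (x *: ext_in a)) ->
  forall u, P u.
Proof. by move=> PD Pt; apply: tens_ind => // a x; rewrite tens_ext_in. Qed.

Lemma dim_scalar_ext : \dim {:scalar_ext f A} = \dim {:A}.
Proof. by rewrite dim_stensor (dimvf F^o) /dim /= muln1. Qed.

Section Univ.
Variables (C : falgType F) (g : {rmorphism A -> C}).
Hypothesis gZ : forall c a, g (c *: a) = f c *: g a.

Definition ext_scal (x : F^o) : C := (x : F) *: 1.
Fact ext_scal_linear : linear ext_scal.
Proof. by move=> c x y; rewrite /ext_scal scalerDl scalerA. Qed.
Fact ext_scal_monoid : monoid_morphism ext_scal.
Proof.
split=> [|x y]; first by rewrite /ext_scal scale1r.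
by rewrite /ext_scal -scalerAl mul1r scalerA.
Qed.
HB.instance Definition _ :=
  GRing.isLinear.Build F F^o C _ ext_scal ext_scal_linear.
HB.instance Definition _ :=
  GRing.isMonoidMorphism.Build F^o C ext_scal ext_scal_monoid.

Lemma ext_scalC a (x : F^o) : g a * ext_scal x = ext_scal x * g a.
Proof. by rewrite /ext_scal -scalerAl -scalerAr mulr1 mul1r. Qed.

Definition ext_univ : scalar_ext f A -> C := tens_univ g ext_scal.

Lemma ext_univ_ex :
  exists gg : {lrmorphism scalar_ext f A -> C}, forall a, gg (ext_in a) = g a.
Proof.
have univM : monoid_morphism ext_univ.
  split; first exact: tens_univ1.
  by apply: tens_univM => //; exact: ext_scalC.
have univL : linear ext_univ by exact: tens_univ_linear.
pose gL := GRing.isLinear.Build F (scalar_ext f A) C _ ext_univ univL.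
pose gM := GRing.isMonoidMorphism.Build (scalar_ext f A) C ext_univ univM.
pose gg : {lrmorphism scalar_ext f A -> C} := HB.pack ext_univ gL gM.
by exists gg => a; rewrite [LHS]tens_univE // rmorph1 mulr1.
Qed.

Lemma scalar_ext_iso :
    \dim {:C} = \dim {:A} ->
    (forall P : C -> Prop, (forall x y, P x -> P y -> P (x + y)) ->
       (forall x a, P (x *: g a)) -> forall c, P c) ->
  alg_iso (scalar_ext f A) C.
Proof.
move=> dimC indC; apply: (tens_univ_iso gZ ext_scalC).
  by rewrite dimC (dimvf F^o) /dim /= muln1.
move=> P PD Pg; apply: indC => // x a.
by have := Pg a x; rewrite /ext_scal -scalerAr mulr1.
Qed.
End Univ.
End Morphism.

Lemma scalar_ext_alg_iso A B :
  alg_iso A B -> alg_iso (scalar_ext f A) (scalar_ext f B).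
Proof.
move=> isoAB; have dimAB := alg_iso_dim isoAB.
case: isoAB => phi [psi phiK psiK].
apply: (@scalar_ext_iso A (scalar_ext f B) (@ext_in B \o phi)) => [c a||].
- by rewrite /= linearZ /= ext_inZ.
- by rewrite dim_scalar_ext.
- move=> P PD Pg; apply: scalar_ext_ind => // x b.
  by have := Pg x (psi b); rewrite /= psiK.
Qed.

Lemma scalar_ext_regular : alg_iso (scalar_ext f E^o) F^o.
Proof.
apply: (@scalar_ext_iso E^o F^o (f : E^o -> F^o)) => [c a||].
- exact: rmorphM.
- by rewrite !dimvf.
- move=> P PD Pg x; have := Pg x 1.
  by rewrite rmorph1 [_ *: _]mulr1.
Qed.
End ScalarExtension.

Lemma scalar_ext_id (F : fieldType) (A : falgType F) :
  alg_iso (scalar_ext idfun A) A.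
Proof.
apply: (@scalar_ext_iso F F idfun A A idfun) => // P PD Pg c.
by have := Pg 1 c; rewrite scale1r.
Qed.

Lemma scalar_ext_comp (D E F : fieldType) (f : {rmorphism D -> E})
    (g : {rmorphism E -> F}) (A : falgType D) :
  alg_iso (scalar_ext g (scalar_ext f A)) (scalar_ext (g \o f) A).
Proof.
apply: alg_iso_sym.
apply: (@scalar_ext_iso D F (g \o f) A _
  (@ext_in E F g (scalar_ext f A) \o @ext_in D E f A)) => [c a||].
- by rewrite /= !ext_inZ.
- by rewrite !dim_scalar_ext.
- move=> P PD Pg; apply: scalar_ext_ind => // x u; move: u x.
  apply: scalar_ext_ind => [u v Hu Hv|y a] x.
    by rewrite rmorphD scalerDr; apply: PD.
  by rewrite ext_inZ scalerA; exact: Pg.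
Qed.

Section TensorIso.
Variable F : fieldType.
Implicit Types A B : falgType F.

Definition tensl A B (a : A) : tensor A B := tens idfun a (1 : B).
Definition tensr A B (b : B) : tensor A B := tens idfun (1 : A) b.

Section Morphisms.
Variables A B : falgType F.

Fact tensl_linear : linear (@tensl A B).
Proof. by move=> c x y; rewrite /tensl tensDl tensZl. Qed.
Fact tensl_monoid : monoid_morphism (@tensl A B).
Proof. by split=> [|x y]; rewrite /tensl ?tens1 // tensM mulr1. Qed.
Fact tensr_linear : linear (@tensr A B).
Proof. by move=> c x y; rewrite /tensr tensDr tensZr. Qed.
Fact tensr_monoid : monoid_morphism (@tensr A B).
Proof. by split=> [|x y]; rewrite /tensr ?tens1 // tensM mulr1. Qed.
HB.instance Definition _ :=
  GRing.isLinear.Build F A (tensor A B) _ (@tensl A B) tensl_linear.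
HB.instance Definition _ :=
  GRing.isMonoidMorphism.Build A (tensor A B) (@tensl A B) tensl_monoid.
HB.instance Definition _ :=
  GRing.isLinear.Build F B (tensor A B) _ (@tensr A B) tensr_linear.
HB.instance Definition _ :=
  GRing.isMonoidMorphism.Build B (tensor A B) (@tensr A B) tensr_monoid.

Lemma tenslr a b : tensl B a * tensr A b = tens idfun a b.
Proof. by rewrite tensM mulr1 mul1r. Qed.

Lemma tenslrC a b : tensl B a * tensr A b = tensr A b * tensl B a.
Proof. by rewrite !tensM !mulr1 !mul1r. Qed.
End Morphisms.

Lemma tensor_alg_iso A A' B B' :
  alg_iso A A' -> alg_iso B B' -> alg_iso (tensor A B) (tensor A' B').
Proof.
move=> isoA isoB; have dimA := alg_iso_dim isoA; have dimB := alg_iso_dim isoB.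
case: isoA isoB => [phi [phi' _ phiK]] [psi [psi' _ psiK]].
apply: (@tens_univ_iso F F idfun A B (tensor A' B')
  (@tensl A' B' \o phi) (@tensr A' B' \o psi)) => [c a|a b||].
- by rewrite /= !linearZ.
- by rewrite /= tenslrC.
- by rewrite dim_stensor dimA dimB.
- move=> P PD Pg; apply: tens_ind => // a b.
  by have := Pg (phi' a) (psi' b); rewrite /= phiK psiK tenslr.
Qed.
End TensorIso.

Lemma scalar_ext_tensor (E F : fieldType) (f : {rmorphism E -> F})
    (A B : falgType E) :
  alg_iso (scalar_ext f (tensor A B))
          (tensor (scalar_ext f A) (scalar_ext f B)).
Proof.
apply: alg_iso_sym; set C := scalar_ext f (tensor A B).
have gZ c a : (@ext_in E F f _ \o @tensl E A B) (c *: a)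
              = f c *: (@ext_in E F f _ \o @tensl E A B) a.
  by rewrite /= linearZ /= ext_inZ.
have hZ c b : (@ext_in E F f _ \o @tensr E A B) (c *: b)
              = f c *: (@ext_in E F f _ \o @tensr E A B) b.
  by rewrite /= linearZ /= ext_inZ.
have [g gE] := ext_univ_ex gZ.
have [h hE] := ext_univ_ex hZ.
have gZ' c u : g (c *: u) = c *: g u by rewrite linearZ.
have hZ' c u : h (c *: u) = c *: h u by rewrite linearZ.
have gD u v : g (u + v) = g u + g v by rewrite rmorphD.
have hD u v : h (u + v) = h u + h v by rewrite rmorphD.
have ghC u v : g u * h v = h v * g u.
  move: u v; apply: scalar_ext_ind => [u v Hu Hv w|x a].
    by rewrite gD mulrDl mulrDr Hu Hv.
  apply: scalar_ext_ind => [u v Hu Hv|y b].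
    by rewrite hD mulrDl mulrDr Hu Hv.
  rewrite gZ' hZ' -!scalerAl -!scalerAr !scalerA (mulrC y) gE hE /=.
  by rewrite -!rmorphM /= tenslrC.
apply: (@tens_univ_iso F F idfun _ _ C g h) => [c a|//||].
- exact: gZ'.
- by rewrite !(dim_scalar_ext, dim_stensor).
- move=> P PD Pg; apply: scalar_ext_ind => // x u; move: u x.
  apply: tens_ind => [u v Hu Hv|a b] x.
    by rewrite rmorphD scalerDr; apply: PD.
  suff <- : g (x *: ext_in f a) * h (ext_in f b) = x *: ext_in f (tens idfun a b).
    exact: Pg.
  by rewrite gZ' gE hE -scalerAl /= -rmorphM /= tenslr.
Qed.

Lemma prodv_ind (F : fieldType) (A : falgType F) (U V : {vspace A})
    (P : A -> Prop) :
    P 0 -> (forall x y, P x -> P y -> P (x + y)) ->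
    (forall u v, u \in U -> v \in V -> P (u * v)) ->
  forall w, w \in (U * V)%VS -> P w.
Proof.
move=> P0 PD PM w; rewrite /prodv unlock => /coord_span ->.
elim/big_ind: _ => // i _; set x := nth _ _ _.
have: x \in allpairs *%R (vbasis U) (vbasis V).
  by apply: mem_nth; rewrite size_allpairs !size_tuple.
case/allpairsP=> -[u v] /= [Uu Vv ->].
by rewrite scalerAl; apply: PM; rewrite ?memvZ ?vbasis_mem.
Qed.

Definition central_simple (F : fieldType) (A : falgType F) : Prop :=
  'Z({:A})%VS = 1%VS /\
  forall I : {vspace A}, ({:A} * I <= I)%VS -> (I * {:A} <= I)%VS ->
    I = 0%VS \/ I = {:A}%VS.

Section CentralSimple.
Variables (F : fieldType) (A : falgType F).

Lemma centerP :
  'Z({:A})%VS = 1%VS <->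
  forall a : A, (forall b, b * a = a * b) -> exists c, a = c%:A.
Proof.
split=> [ZA a aC|ZA].
  by apply/vlineP; rewrite -ZA memv_cap memvf; apply/centvP.
apply/eqP; rewrite eqEsubv; apply/andP; split; apply/subvP=> a.
  rewrite memv_cap => /andP[_ /centvP aC]; apply/vlineP; apply: ZA => b.
  by rewrite aC ?memvf.
by case/vlineP=> c ->; rewrite memv_cap memvf memvZ ?centv1.
Qed.

Lemma simple_span1 (a : A) : central_simple A -> a != 0 ->
  1 \in ({:A} * <[a]> * {:A})%VS.
Proof.
case=> _ simA a0; have full2 : ({:A} * {:A} = {:A} :> {vspace A})%VS.
  by apply/eqP; rewrite eqEsubv subvf; apply/subvP=> x _;
    rewrite -(mul1r x) memv_mul ?memvf.
have aI : a \in ({:A} * <[a]> * {:A})%VS.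
  have := memv_mul (memv_mul (memvf (1 : A)) (memv_line a)) (memvf (1 : A)).
  by rewrite mul1r mulr1.
have [||I0|->] := simA ({:A} * <[a]> * {:A})%VS; rewrite ?memvf //.
- by rewrite !prodvA full2 subvv.
- by rewrite -prodvA full2 subvv.
by move: aI; rewrite I0 memv0 (negPf a0).
Qed.
End CentralSimple.

Section ScalarExtCentralSimple.
Variables (E F : fieldType) (f : {rmorphism E -> F}) (A : falgType E).
Implicit Types (L : seq (F * A)) (M : seq (F * E)).
Local Notation C := (scalar_ext f A).
Local Notation eta := (@ext_in E F f A).

Let val L : C := \sum_(p <- L) p.1 *: eta p.2.
Let comb M : F := \sum_(p <- M) f p.2 * p.1.
Let fsts (T : Type) (L : seq (F * T)) : seq F := map fst L.
Let inspan (s : F) (r : seq F) := exists2 M, fsts M = r & comb M = s.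
Fixpoint indep_seq (r : seq F) : Prop :=
  if r is s :: r' then ~ inspan s r' /\ indep_seq r' else True.

Let val_cons p L : val (p :: L) = p.1 *: eta p.2 + val L.
Proof. by rewrite /val big_cons. Qed.

Let comb_cons p M : comb (p :: M) = f p.2 * p.1 + comb M.
Proof. by rewrite /comb big_cons. Qed.

Let val_rep (u : C) : exists L, indep_seq (fsts L) /\ val L = u.
Proof.
have cons_rep s a L : indep_seq (fsts L) ->
    exists L', indep_seq (fsts L') /\ val L' = s *: eta a + val L.
  move=> indL; have [[M ML Ms]|ns] := classic (inspan s (fsts L)); last first.
    by exists ((s, a) :: L); rewrite val_cons.
  suff [L' [Lf Lv]] : exists L', fsts L' = fsts L /\ val L' = s *: eta a + val L.
    by exists L'; rewrite Lf.
  rewrite -Ms; elim: L M ML {indL Ms} => [|[t b] L IH] [|[t' c] M] //=.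
    by exists [::]; rewrite /comb big_nil scale0r add0r.
  case=> -> /IH[L' [<- IHL]]; exists ((t, b + c *: a) :: L'); split=> //.
  rewrite !val_cons comb_cons /= IHL [eta (_ + _)]rmorphD /= ext_inZ.
  rewrite scalerDr scalerDl scalerA [t * _]mulrC -!addrA addrCA.
  by congr (_ + _); rewrite addrCA.
move: u; apply: scalar_ext_ind => [_ v [L [_ <-]] [L' [iL' <-]]|x a].
  elim: L => [|[s a] L [L1 [iL1 L1E]]]; first by exists L'; rewrite /val big_nil add0r.
  by rewrite val_cons -addrA -L1E; apply: cons_rep.
have [|L' []] := cons_rep x a [::]; first by [].
by rewrite {2}/val big_nil addr0; exists L'.
Qed.

Let indep_comb M : indep_seq (fsts M) -> comb M = 0 ->
  forall p, p \in M -> p.2 = 0.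
Proof.
elim: M => [|[s c] M IH] //= [ns iM]; rewrite comb_cons /= => sM0.
have c0 : c = 0.
  apply: NNPP => /eqP c0; apply: ns.
  exists [seq (p.1, - c^-1 * p.2) | p <- M].
    by rewrite /fsts -map_comp; apply: eq_map.
  rewrite /comb big_map /=.
  under eq_bigr => p _ do rewrite rmorphM -mulrA.
  rewrite -mulr_sumr; apply: (mulfI (x := f c)); first by rewrite fmorph_eq0.
  rewrite mulrA -rmorphM mulrN mulfV // rmorphN1 mulN1r.
  by apply/eqP; rewrite eq_sym -addr_eq0; apply/eqP.
move: sM0; rewrite c0 rmorph0 mul0r add0r => M0 p.
by rewrite in_cons => /orP[/eqP->//|]; apply: IH.
Qed.

Let indep_val L : indep_seq (fsts L) -> val L = 0 ->
  forall p, p \in L -> p.2 = 0.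
Proof.
move=> iL L0 p Lp; rewrite [LHS]acoord_sum big1 // => l _.
have tcM (K : seq (F * A)) :
    tcomp (val K) l = comb [seq (q.1, acoord l q.2) | q <- K].
  elim: K => [|[s a] K IH]; first by rewrite /val /comb !big_nil tcomp0.
  rewrite /= val_cons comb_cons -IH tcompD tcompZ tcomp_tens /=; congr (_ + _).
  by rewrite [_ *: 1]mulr1 mulrC.
have := @indep_comb [seq (q.1, acoord l q.2) | q <- L].
rewrite -tcM L0 tcomp0 {1}/fsts -map_comp (eq_map (g := fst)) //.
move=> /(_ iL erefl (p.1, acoord l p.2)) /= ->; first by rewrite scale0r.
by apply/mapP; exists p.
Qed.

Let commL (b : A) L := [seq (p.1, b * p.2 - p.2 * b) | p <- L].

Let fsts_commL b L : fsts (commL b L) = fsts L.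
Proof. by rewrite /fsts -map_comp; apply: eq_map. Qed.

Let val_commL b L : val (commL b L) = eta b * val L - val L * eta b.
Proof.
rewrite /val mulr_sumr mulr_suml -sumrB big_map; apply: eq_bigr => p _ /=.
by rewrite rmorphB !rmorphM /= -scalerAr -scalerAl scalerBr.
Qed.

Let scal_val L : (forall p, p \in L -> exists c, p.2 = c%:A) ->
  exists2 M, fsts M = fsts L & val L = comb M *: 1.
Proof.
elim: L => [|[s a] L IH] cL.
  by exists [::]; rewrite // /val /comb !big_nil scale0r.
have [|M ML LM] := IH; first by move=> p Lp; apply: cL; rewrite in_cons Lp orbT.
have [c /= ac] := cL _ (mem_head _ _).
exists ((s, c) :: M); first by rewrite /= ML.
rewrite val_cons comb_cons /= LM scalerDl ac ext_inZ rmorph1 scalerA.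
by rewrite [f c * _]mulrC.
Qed.

Let commutes_scal L : 'Z({:A})%VS = 1%VS -> indep_seq (fsts L) ->
  (forall b, val (commL b L) = 0) ->
  forall p, p \in L -> exists c, p.2 = c%:A.
Proof.
move=> /centerP ZA iL L0 p Lp; apply: ZA => b; apply/eqP; rewrite -subr_eq0.
apply/eqP; apply: (@indep_val (commL b L) _ _ (p.1, _)) => //.
  by rewrite fsts_commL.
by apply/mapP; exists p.
Qed.

Let simple_step (I : {vspace C}) s a L :
    central_simple A -> ({:C} * I <= I)%VS -> (I * {:C} <= I)%VS ->
    a != 0 -> val ((s, a) :: L) \in I ->
  exists2 L', fsts L' = fsts L & val ((s, 1) :: L') \in I.
Proof.
move=> csA /prodvP lI /prodvP rI a0 LI.
pose P (z : A) := exists2 L', fsts L' = fsts L & val ((s, z) :: L') \in I.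
have P0 : P 0.
  exists [seq (p.1, 0) | p <- L]; first by rewrite /fsts -map_comp; apply: eq_map.
  rewrite val_cons /= rmorph0 scaler0 add0r /val big_map big1 ?mem0v // => p _.
  by rewrite rmorph0 scaler0.
have addL K : forall L1 L2, fsts L1 = fsts K -> fsts L2 = fsts K ->
    exists2 L3, fsts L3 = fsts K & val L3 = val L1 + val L2.
  elim: K => [|q K IH] [|[t1 b1] L1] [|[t2 b2] L2] //=.
    by move=> _ _; exists [::]; rewrite // /val !big_nil addr0.
  case=> t1E L1f [t2E L2f]; have [L3 L3f L3v] := IH L1 L2 L1f L2f.
  exists ((q.1, b1 + b2) :: L3); first by rewrite /= L3f.
  by rewrite !val_cons L3v /= t1E t2E rmorphD scalerDr addrACA.
have PD x y : P x -> P y -> P (x + y).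
  case=> [L1 L1f L1I] [L2 L2f L2I].
  have [L3 L3f L3v] := addL _ L L1 L2 L1f L2f.
  exists L3 => //; have := memvD L1I L2I.
  by rewrite !val_cons L3v /= rmorphD scalerDr addrACA.
have PM b c z : P z -> P (b * z * c).
  case=> L1 L1f L1I; exists [seq (p.1, b * p.2 * c) | p <- L1].
    by rewrite -L1f /fsts -map_comp; apply: eq_map.
  suff -> : val ((s, b * z * c) :: [seq (p.1, b * p.2 * c) | p <- L1]) =
      eta b * val ((s, z) :: L1) * eta c.
    by rewrite rI ?memvf // lI ?memvf.
  rewrite -(map_cons (fun p => (p.1, b * p.2 * c)) (s, z)) /val big_map.
  rewrite mulr_sumr mulr_suml; apply: eq_bigr => p _ /=.
  by rewrite !rmorphM /= -scalerAr -scalerAl.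
have Pa : P a by exists L.
have Pgen : forall w, w \in ({:A} * <[a]>)%VS -> forall c, P (w * c).
  apply: prodv_ind => [c|x y Px Py c|u _ _ /vlineP[d ->] c].
  - by rewrite mul0r.
  - by rewrite mulrDl; apply: PD.
  by rewrite -scalerAr scalerAl; apply: PM.
by apply: (prodv_ind P0 PD) (simple_span1 csA a0) => u c /Pgen.
Qed.

Let ideal_one (I : {vspace C}) : central_simple A ->
    ({:C} * I <= I)%VS -> (I * {:C} <= I)%VS ->
  forall n L, (size L <= n)%N -> indep_seq (fsts L) -> val L \in I ->
  (exists2 p, p \in L & p.2 != 0) -> 1 \in I.
Proof.
move=> csA lI rI; elim=> [|n IH] [|[s a] L] //=; try by move=> _ _ _ [].
move=> sL [ns iL] LI [p]; rewrite in_cons; have [aE pL p0|a0 _ _] := eqVneq a 0.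
  apply: (IH L) => //; first by move: LI; rewrite aE val_cons /= rmorph0 scaler0 add0r.
  case/orP: pL => [/eqP pE|pL]; last by exists p.
  by move: p0; rewrite pE aE eqxx.
have [L1 L1f L1I] := simple_step csA lI rI a0 LI.
have sL1 : (size L1 <= n)%N by rewrite -(size_map fst) -/(fsts L1) L1f size_map.
have comI b : val (commL b ((s, 1) :: L1)) \in I.
  rewrite val_commL; apply: memvB; first by apply: (prodvP lI); rewrite ?memvf.
  by apply: (prodvP rI); rewrite ?memvf.
have comE b : val (commL b ((s, 1) :: L1)) = val (commL b L1).
  by rewrite /= val_cons /= mulr1 mul1r subrr rmorph0 scaler0 add0r.
have [[b nz]|allz] := classic (exists b, val (commL b L1) <> 0).
  apply: (IH (commL b L1)); rewrite ?size_map ?fsts_commL ?L1f -?comE //.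
  apply: NNPP => nex; apply: nz; rewrite /val big_seq big1 // => q qL.
  have [->|q0] := eqVneq q.2 0; first by rewrite rmorph0 scaler0.
  by case: nex; exists q.
have [|M ML ME] := @scal_val L1.
  apply: commutes_scal; rewrite ?L1f //; first by case: csA.
  by move=> b; apply: NNPP => nz; apply: allz; exists b.
move: L1I; rewrite val_cons ME /= rmorph1 -scalerDl => kI.
have k0 : s + comb M != 0.
  apply/eqP => k0; apply: ns; exists [seq (q.1, - q.2) | q <- M].
    by rewrite -L1f -ML /fsts -map_comp; apply: eq_map.
  rewrite /comb big_map /=; under eq_bigr => q _ do rewrite rmorphN mulNr.
  by rewrite sumrN; apply/esym/eqP; rewrite -addr_eq0 k0.
by rewrite -[1](scalerK k0) memvZ.
Qed.

Lemma scalar_ext_central_simple : central_simple A -> central_simple C.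
Proof.
move=> csA; split=> [|I lI rI].
  apply/centerP => u; have [L [iL <-]] := val_rep u => uC.
  have [|M _ ->] := @scal_val L; last by exists (comb M).
  apply: commutes_scal => // [|b]; first by case: csA.
  by rewrite val_commL uC subrr.
have [->|I0] := eqVneq I 0%VS; [by left | right].
have uI := memv_pick I; have := I0; rewrite -vpick0.
have [L [iL Lu]] := val_rep (vpick I); rewrite -Lu => u0.
rewrite -Lu in uI.
have I1 : 1 \in I.
  apply: (ideal_one csA lI rI (leqnn (size L)) iL uI).
  apply: NNPP => nex; move/eqP: u0; apply.
  rewrite /val big_seq big1 // => q qL.
  have [->|q0] := eqVneq q.2 0; first by rewrite rmorph0 scaler0.
  by case: nex; exists q.
apply/eqP; rewrite eqEsubv subvf; apply/subvP=> x _.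
by rewrite -[x]mulr1; apply: (subvP lI); rewrite memv_mul ?memvf.
Qed.
End ScalarExtCentralSimple.

(* A is [alpha, beta)_{p,F}.  The algebra presented by these generators and
   relations has the basis (i^a j^b), 0 <= a, b < p, so that an algebra of
   dimension p ^ 2 generated by such i and j is isomorphic to it.            *)
Definition symbol_algebra (F : fieldType) (p : nat) (alpha beta : F)
    (A : falgType F) : Prop :=
  \dim {:A} = (p ^ 2)%N /\
  exists i j : A,
    [/\ i ^+ p - i = alpha%:A, j ^+ p = beta%:A,
        j \is a GRing.unit, j * i * j^-1 = i + 1
      & <<1 & [:: i; j]>>%VS = {:A}%VS].

Definition cyclic_algebra (F : fieldType) (p : nat) (A : falgType F) : Prop :=
  exists alpha beta : F, beta != 0 /\ symbol_algebra p alpha beta A.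

Definition decomposable (F : fieldType) (p n : nat) (A : falgType F) : Prop :=
  [/\ central_simple A, \dim {:A} = ((p ^ n) ^ 2)%N
    & exists2 C : 'I_n -> falgType F, forall i, cyclic_algebra p (C i)
        & alg_iso A (\big[@tensor F/(F^o : falgType F)]_(i < n) C i)].

Section ScalarExtDecomposable.
Variables (E F : fieldType) (f : {rmorphism E -> F}).

Lemma scalar_ext_gen (A : falgType E) (r : seq A) :
  <<1 & r>>%VS = {:A}%VS ->
  <<1 & [seq ext_in f a | a <- r]>>%VS = {:scalar_ext f A}%VS.
Proof.
set V := <<1 & map _ r>>%VS => genA.
have V1 : 1 \in V by rewrite (subvP (sub1_agenv _)) ?memv_line.
have VM u v : u \in V -> v \in V -> u * v \in V.
  by move=> Vu Vv; rewrite -[V]agenvM memv_mul.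
have Vr a : a \in <<r>>%VS -> ext_in f a \in V.
  move=> /(@coord_span _ _ _ (in_tuple r)) ->.
  rewrite rmorph_sum memv_suml // => i _ /=.
  rewrite ext_inZ memvZ //; apply: (subvP (sub_agenv _)).
  apply: (subvP (addvSr _ _)); apply/memv_span/map_f/mem_nth.
  exact: ltn_ord.
have VU a : a \in (1 + <<r>>)%VS -> ext_in f a \in V.
  case/memv_addP=> _ /vlineP[c ->] [b /Vr rb ->].
  by rewrite rmorphD memvD //= ext_inZ rmorph1 memvZ.
have VX m : forall a, a \in ((1 + <<r>>) ^+ m)%VS -> ext_in f a \in V.
  elim: m => [|m IH] a.
    by rewrite expv0 => /vlineP[c ->]; rewrite ext_inZ rmorph1 memvZ.
  rewrite expvSl; move: a; apply: prodv_ind => [|x y Vx Vy|u v /VU Vu /IH Vv].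
  - by rewrite rmorph0 mem0v.
  - by rewrite rmorphD memvD.
  - by rewrite rmorphM VM.
have VA a : ext_in f a \in V.
  have : a \in <<1 & r>>%VS by rewrite genA memvf.
  case/memv_sumP=> w wU ->; rewrite rmorph_sum memv_suml // => m _.
  exact/VX/wU.
apply/eqP; rewrite eqEsubv subvf; apply/subvP=> u _; move: u.
by apply: scalar_ext_ind => [u v Vu Vv|x a]; [exact: memvD | exact: memvZ].
Qed.

Lemma scalar_ext_symbol (p : nat) (alpha beta : E) (A : falgType E) :
  symbol_algebra p alpha beta A ->
  symbol_algebra p (f alpha) (f beta) (scalar_ext f A).
Proof.
case=> dimA [i [j [iE jE Uj ijE genA]]]; split; first by rewrite dim_scalar_ext.
exists (ext_in f i), (ext_in f j); split.
- by rewrite -rmorphXn -rmorphB iE /= ext_inZ rmorph1.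
- by rewrite -rmorphXn jE /= ext_inZ rmorph1.
- exact: rmorph_unit.
- by rewrite -rmorphV // -!rmorphM ijE rmorphD rmorph1.
- exact: (@scalar_ext_gen A [:: i; j]).
Qed.

Lemma scalar_ext_big_tensor n (C : 'I_n -> falgType E) :
  alg_iso (scalar_ext f (\big[@tensor E/(E^o : falgType E)]_(i < n) C i))
          (\big[@tensor F/(F^o : falgType F)]_(i < n) scalar_ext f (C i)).
Proof.
elim: n C => [|n IH] C; first by rewrite !big_ord0; exact: scalar_ext_regular.
rewrite !big_ord_recl; apply: alg_iso_trans (scalar_ext_tensor _ _ _) _.
by apply: tensor_alg_iso; [exact: alg_iso_refl | exact: IH].
Qed.

Lemma scalar_ext_decomposable p n (A : falgType E) :
  decomposable p n A -> decomposable p n (scalar_ext f A).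
Proof.
case=> csA dimA [C cycC isoA]; split.
- exact: scalar_ext_central_simple.
- by rewrite dim_scalar_ext.
exists (fun i => scalar_ext f (C i)).
  move=> i; have [alpha [beta [beta0 symC]]] := cycC i.
  exists (f alpha), (f beta); rewrite fmorph_eq0; split=> //.
  exact: scalar_ext_symbol.
exact: alg_iso_trans (scalar_ext_alg_iso f isoA) (scalar_ext_big_tensor C).
Qed.
End ScalarExtDecomposable.

(* Covariant functors from the fields containing k to sets.  A field
   containing k is a field together with a morphism from k to it, and a set is
   given as a type with an equivalence relation.                             *)
Record field_functor (k : fieldType) := FieldFunctor {
  ff_obj : forall F : fieldType, {rmorphism k -> F} -> Type;
  ff_eq : forall (F : fieldType) (iF : {rmorphism k -> F}),
    ff_obj iF -> ff_obj iF -> Prop;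
  ff_map : forall (E F : fieldType) (iE : {rmorphism k -> E})
      (iF : {rmorphism k -> F}) (f : {rmorphism E -> F}),
    f \o iE =1 iF -> ff_obj iE -> ff_obj iF;
  ff_refl : forall (F : fieldType) (iF : {rmorphism k -> F}) (x : ff_obj iF), ff_eq x x;
  ff_sym : forall (F : fieldType) (iF : {rmorphism k -> F}) (x y : ff_obj iF),
    ff_eq x y -> ff_eq y x;
  ff_trans : forall (F : fieldType) (iF : {rmorphism k -> F}) (x y z : ff_obj iF),
    ff_eq x y -> ff_eq y z -> ff_eq x z;
  ff_map_eq : forall (E F : fieldType) (iE : {rmorphism k -> E}) (iF : {rmorphism k -> F})
      (f : {rmorphism E -> F}) (fE : f \o iE =1 iF) (x y : ff_obj iE),
    ff_eq x y -> ff_eq (ff_map fE x) (ff_map fE y);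
  ff_map_id : forall (F : fieldType) (iF : {rmorphism k -> F})
      (idE : (idfun : {rmorphism F -> F}) \o iF =1 iF) (x : ff_obj iF),
    ff_eq (ff_map idE x) x;
  ff_map_comp : forall (D E F : fieldType) (iD : {rmorphism k -> D})
      (iE : {rmorphism k -> E}) (iF : {rmorphism k -> F})
      (f : {rmorphism D -> E}) (g : {rmorphism E -> F})
      (fE : f \o iD =1 iE) (gE : g \o iE =1 iF)
      (gfE : (g \o f : {rmorphism D -> F}) \o iD =1 iF) (x : ff_obj iD),
    ff_eq (ff_map gE (ff_map fE x)) (ff_map gfE x)
}.

Definition Dec (k : fieldType) (p n : nat) : field_functor k :=
  @FieldFunctor k
    (fun F _ => {A : falgType F | decomposable p n A})
    (fun F _ A B => alg_iso (sval A) (sval B))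
    (fun E F _ _ f _ A => exist _ (scalar_ext f (sval A))
                            (scalar_ext_decomposable f (svalP A)))
    (fun F _ A => alg_iso_refl (sval A))
    (fun F _ A B => @alg_iso_sym F (sval A) (sval B))
    (fun F _ A B C => @alg_iso_trans F (sval B) (sval A) (sval C))
    (fun E F _ _ f _ A B => @scalar_ext_alg_iso E F f (sval A) (sval B))
    (fun F _ _ A => scalar_ext_id (sval A))
    (fun D E F _ _ _ f g _ _ _ A => scalar_ext_comp f g (sval A)).

Section TranscendenceDegree.
Variables (k E : fieldType) (iE : {rmorphism k -> E}).

Definition alg_independent (d : nat) (t : 'I_d -> E) : Prop :=
  forall q : {mpoly k[d]}, mmap iE t q = 0 -> q = 0.

(* x belongs to the subfield k(t) of E; a zero denominator only adds x = 0. *)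
Definition in_adjoin (d : nat) (t : 'I_d -> E) (x : E) : Prop :=
  exists q r : {mpoly k[d]}, x = mmap iE t q / mmap iE t r.

Definition transcendence_basis (d : nat) (t : 'I_d -> E) : Prop :=
  alg_independent t /\
  forall x : E, exists P : {poly E},
    [/\ P != 0, forall j, in_adjoin t P`_j & root P x].

Definition has_trdeg (d : nat) : Prop :=
  exists t : 'I_d -> E, transcendence_basis t.
End TranscendenceDegree.

Section EssentialDimension.
Variables (k : fieldType) (Phi : field_functor k).

Definition descends_to (F : fieldType) (iF : {rmorphism k -> F})
    (A : ff_obj Phi iF) (d : nat) : Prop :=
  exists (E : fieldType) (iE : {rmorphism k -> E}) (f : {rmorphism E -> F})
         (fE : f \o iE =1 iF) (B : ff_obj Phi iE),
    has_trdeg iE d /\ ff_eq (ff_map fE B) A.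

(* ed(A) = d *)
Definition is_ed_obj (F : fieldType) (iF : {rmorphism k -> F})
    (A : ff_obj Phi iF) (d : nat) : Prop :=
  descends_to A d /\ forall d', descends_to A d' -> (d <= d')%N.

Definition ed_bound (m : nat) : Prop :=
  forall (F : fieldType) (iF : {rmorphism k -> F}) (A : ff_obj Phi iF),
    exists2 d, is_ed_obj A d & (d <= m)%N.

(* ed(Phi) = e, the least upper bound of the ed(A) *)
Definition is_ed (e : nat) : Prop :=
  ed_bound e /\ forall m, ed_bound m -> (e <= m)%N.
End EssentialDimension.

(* Main.v *)
Require Import Defs.
From HB Require Import structures.
From mathcomp Require Import all_boot all_order all_algebra all_field.
From mathcomp Require Import mpoly zify.
From Stdlib Require Import Classical ClassicalEpsilon.

Set Implicit Arguments.
Unset Strict Implicit.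
Unset Printing Implicit Defensive.

Import GRing.Theory.
Local Open Scope ring_scope.

(* The class of [alpha, beta) depends on alpha only modulo the Artin-Schreier
   elements x^p - x.  Since k is infinite, there are c_1, ..., c_n in k such
   that every family alpha_1, ..., alpha_n in F is, modulo these elements, of
   the form c_1 t, ..., c_n t for a single t in F.  Hence a tensor product of
   the [alpha_i, beta_i) is defined over every subfield that contains k and the
   n + 1 elements t, beta_1, ..., beta_n.  Among the latter there are d <= n + 1
   algebraically independent elements over which all of them are algebraic; the
   subfield of the elements of F algebraic over these has transcendence degree
   d.  Central simplicity descends along the scalar extension. *)

(** * Subfields and transcendence bases *)

Record subfield_pred (F : fieldType) := SubfieldPred {
  subfield_prop :> F -> Prop;
  subfield1 : subfield_prop 1;
  subfieldB : forall x y, subfield_prop x -> subfield_prop y ->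
    subfield_prop (x - y);
  subfield_div : forall x y, subfield_prop x -> subfield_prop y ->
    subfield_prop (x / y)
}.

Section SubfieldType.
Variables (F : fieldType) (S : subfield_pred F).

(** Membership is only a proposition; the informative excluded middle turns it into the boolean
    predicate that a subtype needs. *)
Definition subfield_mem : pred F :=
  fun x => if excluded_middle_informative (S x) then true else false.

Lemma subfield_memP x : reflect (S x) (x \in subfield_mem).
Proof.
rewrite unfold_in /subfield_mem.
by case: excluded_middle_informative; constructor.
Qed.

Fact subfield_mem_closed : divring_closed subfield_mem.
Proof.
split=> [|x y /subfield_memP Sx /subfield_memP Sy
         |x y /subfield_memP Sx /subfield_memP Sy]; apply/subfield_memP.
- exact: subfield1.
- exact: subfieldB.
- exact: subfield_div.
Qed.

HB.instance Definition _ :=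
  GRing.isDivringClosed.Build F subfield_mem subfield_mem_closed.

Record subfield_type :=
  SubfieldType { subfield_val : F; _ : subfield_val \in subfield_mem }.

HB.instance Definition _ := [isSub for subfield_val].
HB.instance Definition _ := [Choice of subfield_type by <:].
HB.instance Definition _ := [SubChoice_isSubComUnitRing of subfield_type by <:].
HB.instance Definition _ :=
  [SubComUnitRing_isSubIntegralDomain of subfield_type by <:].
HB.instance Definition _ :=
  [SubIntegralDomain_isSubField of subfield_type by <:].

Lemma subfield_field : exists (K : fieldType) (v : {rmorphism K -> F}),
  forall x, S x <-> exists y, v y = x.
Proof.
exists subfield_type, (val : {rmorphism subfield_type -> F}) => x; split.
  by move=> /subfield_memP Sx; exists (SubfieldType Sx).
by case=> -[y Sy] <-; apply/subfield_memP.
Qed.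
End SubfieldType.

(** Since [v] is injective, the chosen preimages inherit the identities satisfied by [f]. *)
Lemma rmorphism_lift (k K F : fieldType) (f : {rmorphism k -> F})
    (v : {rmorphism K -> F}) : (forall c, exists y, v y = f c) ->
  exists g : {rmorphism k -> K}, v \o g =1 f.
Proof.
move=> vf; pose g c := sval (constructive_indefinite_description _ (vf c)).
have vg c : v (g c) = f c.
  exact: svalP (constructive_indefinite_description _ (vf c)).
have gB : zmod_morphism g.
  by move=> x y; apply: (fmorph_inj v); rewrite rmorphB !vg rmorphB.
have gM : monoid_morphism g.
  split=> [|x y]; apply: (fmorph_inj v); first by rewrite vg !rmorph1.
  by rewrite rmorphM !vg rmorphM.
pose gA := GRing.isZmodMorphism.Build k K g gB.
pose gR := GRing.isMonoidMorphism.Build k K g gM.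
pose gg : {rmorphism k -> K} := HB.pack g gA gR.
by exists gg => c; exact: vg.
Qed.

Lemma map_poly_lift (K F : fieldType) (v : {rmorphism K -> F}) (P : {poly F}) :
  (forall j, exists y, v y = P`_j) -> exists Q, map_poly v Q = P.
Proof.
elim/poly_ind: P => [|P c IH] PK; first by exists 0; rewrite map_poly0.
have [j|Q QP] := IH; first by have := PK j.+1; rewrite coefD coefMX coefC addr0.
have [a] := PK 0; rewrite coefD coefMX coefC add0r => ac.
exists (Q * 'X + a%:P).
by rewrite rmorphD rmorphM /= map_polyX map_polyC /= QP ac.
Qed.

(** * The field k(t) and its algebraic closure in F *)

Section Adjoin.
Variables (k F : fieldType) (f : {rmorphism k -> F}) (d : nat) (t : 'I_d -> F).
Local Notation in_adj := (in_adjoin f t).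
Local Notation ev := (mmap f t).

Lemma in_adjoin_mmap q : in_adj (ev q).
Proof. by exists q, 1; rewrite rmorph1 divr1. Qed.

Lemma in_adjoin_denom x : in_adj x ->
  exists q r, ev r != 0 /\ x = ev q / ev r.
Proof.
(* A quotient with denominator 0 has the value 0 and is replaced by 0 / 1. *)
case=> q [r ->]; have [r0|] := eqVneq (ev r) 0; last by exists q, r.
by exists 0, 1; rewrite r0 rmorph1 rmorph0 oner_neq0 invr0 mulr0 mul0r.
Qed.

Definition adjoin : subfield_pred F.
Proof.
apply: (@SubfieldPred F (in_adjoin f t)) => [
  |_ _ /in_adjoin_denom[q [r [r0 ->]]] /in_adjoin_denom[q' [r' [r0' ->]]]
  |_ _ [q [r ->]] [q' [r' ->]]].
- by rewrite -(rmorph1 ev); exact: in_adjoin_mmap.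
- exists (q * r' - q' * r), (r * r').
  by rewrite -mulNr addf_div // rmorphB !rmorphM mulNr.
- by exists (q * r'), (r * q'); rewrite !rmorphM invf_div mulf_div.
Defined.

Definition algebraic_over (x : F) : Prop :=
  exists P : {poly F}, [/\ P != 0, forall j, in_adj P`_j & root P x].

(** Once k(t) is the image of a field [K], the closure properties of [algebraicOver] become
    available. *)
Lemma algebraic_overP (K : fieldType) (v : {rmorphism K -> F}) :
    (forall x, in_adj x <-> exists y, v y = x) ->
  forall x, algebraic_over x <-> algebraicOver v x.
Proof.
move=> vP x; split=> [[P [P0 PK Px]]|[Q Q0 Qx]].
  have [j|Q QP] := @map_poly_lift K F v P; first exact/vP/PK.
  by exists Q; rewrite ?QP // -(map_poly_eq0 v) QP.
exists (map_poly v Q); rewrite map_poly_eq0; split=> // j.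
by apply/vP; exists Q`_j; rewrite coef_map.
Qed.

Lemma in_adjoin_algebraic x : in_adj x -> algebraic_over x.
Proof.
have [K [v vP]] := subfield_field adjoin.
by move=> /vP[y <-]; apply/(algebraic_overP vP)/algebraic_id.
Qed.

Lemma algebraic_closure_sub :
  [/\ algebraic_over 1,
      forall x y,
        algebraic_over x -> algebraic_over y -> algebraic_over (x - y)
    & forall x y,
        algebraic_over x -> algebraic_over y -> algebraic_over (x / y)].
Proof.
have [K [v vP]] := subfield_field adjoin; have aP := algebraic_overP vP.
split=> [|x y /aP ax /aP ay|x y /aP ax /aP ay]; apply/aP.
- exact: algebraic1.
- exact: algebraic_sub.
- exact: algebraic_div.
Qed.

Definition algebraic_closure : subfield_pred F :=
  let: And3 c1 cB cV := algebraic_closure_sub in SubfieldPred c1 cB cV.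

Lemma algebraic_closureE x : algebraic_closure x <-> algebraic_over x.
Proof. by rewrite /algebraic_closure; case: algebraic_closure_sub. Qed.

(** The [t j] come from elements [s j] of [E]. Relations between the [s j] map to relations between
    the [t j], and a polynomial over k(t) that kills [v x] lifts to one over k(s) that kills [x]. *)
Lemma algebraic_closure_trdeg (E : fieldType) (g : {rmorphism k -> E})
    (v : {rmorphism E -> F}) : v \o g =1 f -> alg_independent f t ->
    (forall x, algebraic_over x <-> exists y, v y = x) ->
  has_trdeg g d.
Proof.
move=> vg indt vP.
have lift x : in_adj x -> exists y, v y = x by move=> /in_adjoin_algebraic/vP.
have tE j : exists y, v y = t j.
  by apply: lift; exists 'X_j, 1; rewrite rmorph1 divr1 mmapX mmap1U.
pose s j := sval (constructive_indefinite_description _ (tE j)).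
have vs j : v (s j) = t j.
  exact: svalP (constructive_indefinite_description _ (tE j)).
have evs q : v (mmap g s q) = ev q.
  rewrite rmorph_sum; apply: eq_bigr => m _; rewrite rmorphM [v _]vg.
  congr (_ * _); rewrite rmorph_prod; apply: eq_bigr => j _.
  by rewrite rmorphXn /= vs.
exists s; split=> [q q0|x].
  by apply: indt; rewrite -evs q0 rmorph0.
have /vP[P [P0 PK Px]] : exists y, v y = v x by exists x.
have [j|Q QP] := @map_poly_lift E F v P; first exact/lift/PK.
exists Q; split; first by rewrite -(map_poly_eq0 v) QP.
  move=> j; have [q [r]] := PK j; rewrite -QP coef_map -!evs -fmorph_div.
  by move=> /fmorph_inj; exists q, r.
by rewrite -(fmorph_root v) QP.
Qed.
End Adjoin.

(** * Transcendence bases extracted from finite families *)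

Local Notation widen := (widen_ord (leqnSn _)).

Lemma lift_max_widen n (i : 'I_n) : lift ord_max i = widen i.
Proof. by apply: val_inj; exact: lift_max. Qed.

(** The coefficient of [q] at [m] reappears in [muni q] at degree [m ord_max] and at the remaining
    exponents, where no other monomial contributes. *)
Lemma muni_eq0 (R : comNzRingType) n (q : {mpoly R[n.+1]}) :
  muni q = 0 -> q = 0.
Proof.
move=> q0; apply/mpolyP=> m; rewrite mcoeff0; apply/eqP/negPn/negP => qm.
have mq : m \in msupp q by rewrite mcoeff_msupp.
have := congr1 (fun P : {poly {mpoly R[n]}} =>
  P`_(m ord_max) @_[multinom m (widen i) | i < n]) q0.
rewrite /= muniE coef_sum raddf_sum coef0 mcoeff0 /=.
rewrite (bigD1_seq m mq) ?msupp_uniq //= big1 => [|m' m'm].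
  rewrite coefZ coefXn eqxx mulr1 mcoeffZ mcoeffX eqxx mulr1 addr0.
  by apply/eqP.
rewrite coefZ coefXn; case: eqP => [mE|_]; last by rewrite mulr0 mcoeff0.
rewrite mulr1 mcoeffZ mcoeffX; case: eqP => [wE|_]; last by rewrite mulr0.
case/eqP: m'm; apply/mnmP => i; have [j ->|->//] := unliftP ord_max i.
have := congr1 (fun u : 'X_{1..n} => u j) wE; rewrite !mnmE.
by rewrite lift_max_widen.
Qed.

Section Transcendence.
Variables (k F : fieldType) (f : {rmorphism k -> F}).

Lemma muni_mmap n (s : 'I_n.+1 -> F) (q : {mpoly k[n.+1]}) :
  (map_poly (mmap f (s \o widen)) (muni q)).[s ord_max] = mmap f s q.
Proof.
rewrite muniE [map_poly _ _]raddf_sum horner_sum; apply: eq_bigr => m _ /=.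
rewrite map_polyZ map_polyXn hornerZ hornerXn /= mmapZ mmapX -mulrA.
congr (_ * _); rewrite /mmap1 big_ord_recr /=; congr (_ * _).
by apply: eq_bigr => i _; rewrite mnmE.
Qed.

Lemma mmap_mwiden n (s : 'I_n.+1 -> F) (q : {mpoly k[n]}) :
  mmap f s (mwiden q) = mmap f (s \o widen) q.
Proof.
rewrite [mwiden q](_ : _ = \sum_(m <- msupp q)
  (q@_m)%:MP * mmap1 (fun i => 'X_(widen i)) m) // rmorph_sum.
apply: eq_bigr => m _.
rewrite rmorphM /= mmapC rmorph_prod; congr (_ * _).
by apply: eq_bigr => i _; rewrite rmorphXn /= mmapX mmap1U.
Qed.

(** By induction on [n]: the last element is dropped if it is algebraic over the elements [s]
    already chosen, and appended to them otherwise. *)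
Lemma transcendence_basis_sub n (t : 'I_n -> F) :
  exists d (s : 'I_d -> F), [/\ (d <= n)%N, alg_independent f s
    & forall j, algebraic_over f s (t j)].
Proof.
elim: n t => [|n IH] t.
  exists 0, t; split=> // [q q0|[]//].
  move: q0; rewrite [q](_ : _ = (q@_0%MM)%:MP); last first.
    apply/mpolyP => m; rewrite mcoeffC.
    suff -> : m = 0%MM by rewrite eqxx mulr1.
    by apply/mnmP => -[].
  by rewrite mmapC => /eqP; rewrite fmorph_eq0 => /eqP->.
have [d [s [dn inds alg_s]]] := IH (t \o widen).
have [alg_t|trans_t] := classic (algebraic_over f s (t ord_max)).
  exists d, s; split=> // [|j]; first exact: leqW.
  have [i ->|->//] := unliftP ord_max j.
  rewrite lift_max_widen; exact: alg_s.
pose s' (j : 'I_d.+1) := if unlift ord_max j is Some i then s i else t ord_max.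
have s'w : s' \o widen =1 s.
  by move=> i; rewrite /s' /= -lift_max_widen liftK.
have s'm : s' ord_max = t ord_max by rewrite /s' unlift_none.
have mw q : mmap f (s' \o widen) q = mmap f s q.
  by apply: eq_bigr => m _; congr (_ * _); exact: mmap1_eq.
exists d.+1, s'; split=> // [q q0|j].
  (* By independence of [s], a nonzero relation [q] would leave a nonzero polynomial over k(s) with
     root [t ord_max]. *)
  apply: muni_eq0; apply: NNPP => /eqP mq0; apply: trans_t.
  exists (map_poly (mmap f s) (muni q)); split.
  - apply: contra mq0 => /eqP mq0; apply/eqP/polyP => i; rewrite coef0.
    by apply: inds; rewrite -[RHS](coef0 _ i) -mq0 coef_map.
  - by move=> i; rewrite coef_map; apply: in_adjoin_mmap.
  - by rewrite /root -s'm -(eq_map_poly mw) muni_mmap q0.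
have sub x : in_adjoin f s x -> in_adjoin f s' x.
  by case=> q [r ->]; exists (mwiden q), (mwiden r); rewrite !mmap_mwiden !mw.
have [i ->|->] := unliftP ord_max j.
  rewrite lift_max_widen; have [P [P0 PK Pt]] := alg_s i.
  by exists P; split=> // l; apply/sub/PK.
apply: in_adjoin_algebraic; rewrite -s'm.
by exists 'X_ord_max, 1; rewrite rmorph1 divr1 mmapX mmap1U.
Qed.
End Transcendence.

(** * Artin-Schreier elements *)

(** An algebraically closed field is infinite: [s] is a non-root of the product of all X^(u l) -
    X^(u m), each nonzero by comparison of degrees. *)
Lemma closed_field_expr_inj (k : closedFieldType) (u : nat -> nat) n :
    {in gtn n &, injective u} ->
  exists s : k, {in gtn n &, injective (fun l => s ^+ u l)}.
Proof.
move=> u_inj.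
pose Q : {poly k} :=
  \prod_(l < n) \prod_(m < n | m != l) ('X^(u l) - 'X^(u m)).
have /closed_nonrootP[s Qs] : Q != 0.
  apply/prodf_neq0 => l _; apply/prodf_neq0 => m ml.
  rewrite subr_eq0; apply: contra ml.
  move=> /eqP/(congr1 (fun P : {poly k} => size P)).
  by rewrite !size_polyXn => -[/u_inj-/(_ (ltn_ord l) (ltn_ord m))/val_inj->].
exists s => l m ln mn slm; apply/eqP; apply: contraR Qs => lm.
rewrite /root /Q (bigD1 (Ordinal ln)) //= (bigD1 (Ordinal mn)) /=; last first.
  by rewrite eq_sym.
by rewrite !hornerM !hornerE slm subrr !mul0r.
Qed.

Lemma vandermonde_unit (k : fieldType) n (x : nat -> k) :
    {in gtn n &, injective x} ->
  \matrix_(i < n, l < n) x l ^+ i \in unitmx.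
Proof.
move=> x_inj.
rewrite [X in X \in _](_ : _ = Vandermonde n (\row_l x l)); last first.
  by apply/matrixP=> i l; rewrite !mxE.
rewrite unitmxE det_Vandermonde unitfE; apply/prodf_neq0 => i _.
apply/prodf_neq0 => j ij; rewrite !mxE subr_eq0; apply: contraL ij => /eqP xji.
by rewrite (x_inj _ _ (ltn_ord j) (ltn_ord i) xji) ltnn.
Qed.

Section ArtinSchreier.
Variables (F : fieldType) (p : nat).
Hypothesis charF : p \in [pchar F].

Definition artin_schreier (a : F) := exists x, a = x ^+ p - x.

Lemma artin_schreier_sum I (r : seq I) (P : pred I) (a : I -> F) :
  (forall i, P i -> artin_schreier (a i)) ->
  artin_schreier (\sum_(i <- r | P i) a i).
Proof.
move=> aP; elim/big_ind: _ => [|_ _ [x ->] [y ->]|//].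
  by exists 0; rewrite expr0n subr0 gtn_eqF ?prime_gt0 ?(pcharf_prime charF).
exists (x + y); rewrite -!(pFrobenius_autE charF) rmorphD /= opprD.
by rewrite addrACA.
Qed.

(** The sum telescopes for x = a + a^p + ... + a^(p^(l-1)). *)
Lemma artin_schreier_expr (a : F) l : artin_schreier (a ^+ (p ^ l) - a).
Proof.
have p_gt0 := prime_gt0 (pcharf_prime charF).
elim: l => [|l [x ax]]; first by exists 0; rewrite expr0n gtn_eqF // !subrr.
exists (x + a ^+ (p ^ l)).
rewrite -(pFrobenius_autE charF) rmorphD /= !pFrobenius_autE -exprM -expnSr.
by rewrite opprD addrACA -ax addrC addrA subrK.
Qed.
End ArtinSchreier.

(* Choose s in k with s^(p^0), ..., s^(p^n) distinct.  The matrix with entries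
   N i l = s^(i p^(n - l)) is invertible by Vandermonde; let b be its inverse,
   c i = s^(i p^n) = (N i l)^(p^l) and t = \sum_(l, j) (b l j * a j)^(p^l).
   Then c i * t = \sum_(l, j) (N i l * b l j * a j)^(p^l), which is congruent
   to \sum_(l, j) N i l * b l j * a j = a i. *)
Lemma artin_schreier_common_multiple (k : closedFieldType) (F : fieldType)
    (f : {rmorphism k -> F}) p n (a : 'I_n -> F) : p \in [pchar k] ->
  exists (c : 'I_n -> k) (t : F),
    forall i, artin_schreier p (f (c i) * t - a i).
Proof.
move=> chark; have charF : p \in [pchar F] by rewrite (fmorph_pchar f).
have p_gt1 := prime_gt1 (pcharf_prime chark).
case: n a => [|n] a; first by exists (fun=> 0), 0 => -[].
pose u l := (p ^ (n - l))%N.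
have [|s s_inj] := @closed_field_expr_inj k u n.+1.
  move=> l m; rewrite !inE /= !ltnS => ln mn /eqP.
  by rewrite eqn_exp2l // => /eqP/(congr1 (subn n)); rewrite !subKn.
pose N := \matrix_(i < n.+1, l < n.+1) (s ^+ u l) ^+ i.
have Nu : N \in unitmx by exact: vandermonde_unit s_inj.
pose b := invmx N.
exists (fun i => s ^+ (i * p ^ n)).
exists (\sum_l \sum_j (f (b l j) * a j) ^+ (p ^ l)) => i.
have -> : a i = \sum_l \sum_j f (N i l * b l j) * a j.
  rewrite exchange_big /= (bigD1 i) //= [X in _ + X]big1 => [|j ji].
    rewrite addr0 -mulr_suml -rmorph_sum.
    have := congr1 (fun M : 'M_n.+1 => M i i) (mulmxV Nu).
    by rewrite !mxE eqxx => ->; rewrite rmorph1 mul1r.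
  rewrite -mulr_suml -rmorph_sum.
  have := congr1 (fun M : 'M_n.+1 => M i j) (mulmxV Nu).
  by rewrite !mxE eq_sym (negPf ji) => ->; rewrite rmorph0 mul0r.
rewrite mulr_sumr -sumrB; apply: (artin_schreier_sum charF) => l _.
rewrite mulr_sumr -sumrB; apply: (artin_schreier_sum charF) => j _.
have -> : s ^+ (i * p ^ n) = N i l ^+ (p ^ l).
  by rewrite mxE -!exprM /u mulnCA -expnD (subnK (ltn_ord l : (l <= n)%N)).
rewrite rmorphXn /= -exprMn mulrA -rmorphM.
exact: (artin_schreier_expr charF).
Qed.

(** * Symbol algebras *)

(** The last relation avoids j^-1; invertibility of [j] and generation are recovered in
    [symbol_algebraP]. *)
Definition symbol_pair (F : fieldType) (p : nat) (alpha beta : F)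
    (A : falgType F) (i j : A) : Prop :=
  [/\ i ^+ p - i = alpha%:A, j ^+ p = beta%:A & j * i = (i + 1) * j].

Lemma natr_pchar_inj (R : nzRingType) p : p \in [pchar R] ->
  {in gtn p &, injective (fun b => b%:R : R)}.
Proof.
move=> charR b b' bp b'p /eqP.
wlog bb' : b b' bp b'p / (b <= b')%N => [IH|].
  case/orP: (leq_total b b') => bb'; first exact: IH.
  by rewrite eq_sym => E; apply/esym/IH.
rewrite eq_sym -subr_eq0 -natrB // -(dvdn_pcharf charR) => /dvdn_leq.
move: bp b'p; rewrite !inE /=; lia.
Qed.

Section SymbolCombination.
Variables (F : fieldType) (p : nat) (A : falgType F) (i j : A).

(** With coefficients stored in a matrix, independence and spanning of the monomials i^a j^b become
    injectivity and surjectivity of one linear map. *)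
Definition symbol_comb (M : 'M[F]_p) : A :=
  \sum_a \sum_b M a b *: (i ^+ a * j ^+ b).

Fact symbol_comb_linear : linear symbol_comb.
Proof.
move=> c M N; rewrite /symbol_comb scaler_sumr -big_split.
apply: eq_bigr => a _.
rewrite scaler_sumr -big_split; apply: eq_bigr => b _ /=.
by rewrite !mxE scalerDl scalerA.
Qed.
HB.instance Definition _ :=
  GRing.isLinear.Build F 'M[F]_p A _ symbol_comb symbol_comb_linear.

Lemma symbol_comb_delta a b :
  symbol_comb (delta_mx a b) = i ^+ a * j ^+ b.
Proof.
rewrite /symbol_comb (bigD1 a) //= (bigD1 b) //= !mxE !eqxx scale1r.
rewrite !big1 ?addr0 // => [a' a'a|b' b'b]; last first.
  by rewrite mxE (negPf b'b) andbF scale0r.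
by rewrite big1 // => b' _; rewrite mxE (negPf a'a) scale0r.
Qed.
End SymbolCombination.

Section SymbolPair.
Variables (F : fieldType) (p : nat) (alpha beta : F).
Hypotheses (charF : p \in [pchar F]) (beta0 : beta != 0).

Lemma symbol_pair_unit (A : falgType F) (i j : A) :
  symbol_pair p alpha beta i j -> j \is a GRing.unit.
Proof.
case=> _ jp _; rewrite -(unitrX_pos _ (prime_gt0 (pcharf_prime charF))) jp.
by rewrite scaler_unit ?unitr1 ?unitfE.
Qed.

(** The scalar x commutes with [i], so Frobenius is additive on their sum. *)
Lemma symbol_pair_shift (A : falgType F) (i j : A) (x : F) :
    symbol_pair p alpha beta i j ->
  symbol_pair p (alpha + (x ^+ p - x)) beta (i + x%:A) j.
Proof.
have charA : p \in [pchar A] by rewrite (pchar_lalg A).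
case=> ip jp ji; split=> //.
  have ix : GRing.comm i x%:A by rewrite /GRing.comm mulr_algl mulr_algr.
  rewrite -(pFrobenius_autE charA) pFrobenius_autD_comm //= !pFrobenius_autE.
  by rewrite opprD addrACA ip exprZn expr1n -scalerBl -scalerDl.
by rewrite mulrDr ji mulr_algr [in RHS]addrAC [in RHS]mulrDl mulr_algl.
Qed.

(** * Linear independence of the monomials i^a j^b *)

Section Independence.
Variables (A : falgType F) (i j : A).
Hypothesis ij : symbol_pair p alpha beta i j.

Lemma symbol_pair_exprr b : j ^+ b * i = (i + b%:R) * j ^+ b.
Proof.
have [_ _ ji] := ij; elim: b => [|b IH]; first by rewrite addr0 mul1r mulr1.
rewrite exprSr -mulrA ji mulrA mulrDr mulr1 IH -natr1 addrA.
by rewrite [RHS]mulrA; congr (_ * _); rewrite [RHS]mulrDl mul1r.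
Qed.

Lemma symbol_pair_horner_shift (q : {poly F}) :
  horner_alg i (q \Po ('X + 1%:P)) * j = j * horner_alg i q.
Proof.
have [_ _ ji] := ij; elim/poly_ind: q => [|q c IH].
  by rewrite comp_poly0 rmorph0 mulr0 mul0r.
rewrite comp_polyD comp_polyM comp_polyX comp_polyC !rmorphD !rmorphM /=.
rewrite rmorphD /= !horner_algX !horner_algC scale1r [LHS]mulrDl [RHS]mulrDr.
by rewrite mulr_algl mulr_algr -mulrA -ji [in LHS]mulrA IH mulrA.
Qed.

(* Conjugation by j shows that q(X + 1) - q, which has smaller degree, also
   kills i; by induction q(X + 1) = q, so q - q(0) vanishes on the prime field. *)
Lemma symbol_pair_poly_free (q : {poly F}) :
  (size q <= p)%N -> horner_alg i q = 0 -> q = 0.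
Proof.
move: {2}(size q).+1 (ltnSn (size q)) => n; elim: n q => // n IH q qn qp qi0.
have [->//|q0] := eqVneq q 0.
have sX : size ('X + 1%:P : {poly F}) = 2 by rewrite size_XaddC.
have sq : size (q \Po ('X + 1%:P)) = size q by rewrite size_comp_poly2.
pose r := q \Po ('X + 1%:P) - q.
have rq : (size r < size q)%N.
  rewrite -[X in (_ < X)%N]prednK ?size_poly_gt0 // ltnS; apply/leq_sizeP => m.
  rewrite leq_eqVlt => /predU1P[<-|qm]; last first.
    rewrite prednK ?size_poly_gt0 // in qm.
    by rewrite coefB !nth_default ?subr0 ?sq.
  rewrite coefB -{1}sq -!lead_coefE lead_coef_comp ?sX //.
  by rewrite lead_coefXaddC expr1n mulr1 subrr.
have r0 : r = 0.
  apply: IH; [exact: leq_trans rq qn | exact: leq_trans (ltnW rq) qp |].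
  have ju := symbol_pair_unit ij.
  apply: (mulIr ju); rewrite rmorphB mulrBl /= symbol_pair_horner_shift qi0.
  by rewrite mulr0 mul0r subr0.
have qS b : q.[b%:R] = q.[0].
  elim: b => // b <-; have /(congr1 (fun P : {poly F} => P.[b%:R])) := r0.
  rewrite /r hornerD hornerN horner_comp !hornerE natr1 => /eqP.
  by rewrite subr_eq0 => /eqP.
have : q - q.[0]%:P == 0.
  apply/negPn/negP => nz.
  (* The [p] elements of the prime field are too many roots for a nonzero polynomial of size at most
     [p]. *)
  pose rs : seq F := [seq b%:R | b <- iota 0 p].
  have := @max_poly_roots F (q - q.[0]%:P) rs nz.
  have -> : all (root (q - q.[0]%:P)) rs.
    by apply/allP => _ /mapP[b _ ->]; rewrite /root !hornerE qS subrr.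
  have -> : uniq rs.
    rewrite map_inj_in_uniq ?iota_uniq // => b b'; rewrite !mem_iota.
    exact: (natr_pchar_inj charF).
  rewrite size_map size_iota ltnNge (leq_trans (size_polyD _ _)) //.
    by move=> /(_ isT isT).
  rewrite geq_max qp size_polyN (leq_trans (size_polyC_leq1 _)) //.
  exact: prime_gt0 (pcharf_prime charF).
rewrite subr_eq0 => /eqP qc; move: qi0; rewrite qc horner_algC => /eqP.
by rewrite scaler_eq0 oner_eq0 orbF => /eqP->.
Qed.

(* For q b commuting with i, the commutator with i multiplies q b * j ^+ b by b,
   so the terms with different b are separated by Lagrange interpolation. *)
Lemma symbol_comb_inj : injective (symbol_comb (p := p) i j).
Proof.
have ju := symbol_pair_unit ij.
suff inj0 : forall M : 'M[F]_p, symbol_comb i j M = 0 -> M = 0.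
  move=> M N /eqP; rewrite -subr_eq0 -linearB => /eqP/inj0/eqP.
  by rewrite subr_eq0 => /eqP.
move=> M M0; pose q (b : 'I_p) : A := \sum_a M a b *: i ^+ a.
have qM : \sum_b q b * j ^+ b = 0.
  rewrite -[RHS]M0 /symbol_comb exchange_big; apply: eq_bigr => b _.
  by rewrite mulr_suml; apply: eq_bigr => a _; rewrite scalerAl.
have qi b : q b * i = i * q b.
  rewrite mulr_suml mulr_sumr; apply: eq_bigr => a _.
  by rewrite -scalerAl -scalerAr -exprSr exprS.
(* Multiplying [g] by 'X amounts to a commutator with [i]; constants are handled by [qM]. *)
have gM (g : {poly F}) : \sum_(b < p) g.[b%:R] *: (q b * j ^+ b) = 0.
  elim/poly_ind: g => [|g c IH].
    by rewrite big1 // => b _; rewrite horner0 scale0r.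
  pose S := \sum_(b < p) g.[b%:R] *: (q b * j ^+ b).
  have SE : S * i - i * S = \sum_(b < p) (g.[b%:R] * b%:R) *: (q b * j ^+ b).
    rewrite mulr_suml mulr_sumr -sumrB; apply: eq_bigr => b _.
    rewrite -scalerAl -scalerAr -scalerBr -scalerA; congr (_ *: _).
    rewrite -mulrA symbol_pair_exprr !mulrA mulrDr qi mulrDl addrAC subrr add0r.
    by rewrite mulr_natr mulrnAl scaler_nat.
  under eq_bigr => b _ do rewrite hornerMXaddC scalerDl.
  rewrite big_split /= -SE /S IH mulr0 mul0r subrr add0r.
  by rewrite -scaler_sumr qM scaler0.
have q0 b : q b = 0.
  pose g : {poly F} := \prod_(b' < p | b' != b) ('X - b'%:R%:P).
  have := gM g; rewrite (bigD1 b) //= big1 => [|b' b'b]; last first.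
    by rewrite /g horner_prod (bigD1 b') //= !hornerE subrr mul0r scale0r.
  rewrite addr0 => /eqP; rewrite scaler_eq0 => /orP[|/eqP qj]; last first.
    by apply: (mulIr (unitrX b ju)); rewrite qj mul0r.
  rewrite /g horner_prod prodf_seq_eq0 => /hasP[b' _ /andP[b'b]].
  rewrite !hornerE subr_eq0 => /eqP.
  move=> /(natr_pchar_inj charF (ltn_ord b) (ltn_ord b'))/val_inj bb'.
  by rewrite bb' eqxx in b'b.
apply/matrixP=> a b; rewrite mxE.
(* Column [b] of [M] is read as a polynomial that kills [i]. *)
pose Q := \poly_(m < p) (if insub m is Some a' then M a' b else 0).
have Q0 : Q = 0.
  apply: symbol_pair_poly_free; first exact: size_poly.
  rewrite -[RHS](q0 b) /Q poly_def rmorph_sum; apply: eq_bigr => a' _ /=.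
  by rewrite linearZ rmorphXn /= horner_algX valK mulr_algl.
have := congr1 (fun P : {poly F} => P`_a) Q0.
by rewrite coef0 coef_poly ltn_ord valK.
Qed.
End Independence.

(** * The multiplication table is determined by the relations *)

Section Graph.
Variables (A A' : falgType F) (i j : A) (i' j' : A').
Hypotheses (ij : symbol_pair p alpha beta i j).
Hypotheses (ij' : symbol_pair p alpha beta i' j').

(* With A' = A and (i', j') = (i, j), the stability of [graph] says that the
   image of [symbol_comb] is a subalgebra. *)
Let graph (x : A) (x' : A') :=
  exists2 M : 'M[F]_p, x = symbol_comb i j M & x' = symbol_comb i' j' M.

Let graph0 : graph 0 0.
Proof. by exists 0; rewrite linear0. Qed.

Let graphD x x' y y' : graph x x' -> graph y y' -> graph (x + y) (x' + y').
Proof. by case=> M -> -> [N -> ->]; exists (M + N); rewrite linearD. Qed.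

Let graphZ c x x' : graph x x' -> graph (c *: x) (c *: x').
Proof. by case=> M -> ->; exists (c *: M); rewrite linearZ. Qed.

(** The relations i^p = i + alpha and j^p = beta bring the exponents below [p] in the same way on
    both sides; each use lowers m + b because p > 1. *)
Let graph_monomial m b : graph (i ^+ m * j ^+ b) (i' ^+ m * j' ^+ b).
Proof.
have [ip jp _] := ij; have [ip' jp' _] := ij'.
have p_gt1 := prime_gt1 (pcharf_prime charF).
move: {2}(m + b).+1%N (ltnSn (m + b)) => n; elim: n m b => // n IH m b mbn.
have [pm|mp] := leqP p m.
  move: mbn; rewrite -(subnK pm) !exprD.
  move/eqP: ip; rewrite subr_eq => /eqP->.
  move/eqP: ip'; rewrite subr_eq => /eqP->.
  rewrite !mulrDr !mulrDl !mulr_algr -!scalerAl -!exprSr => mbn.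
  apply: graphD; first by apply/graphZ/IH; lia.
  by apply: IH; lia.
have [pb|bp] := leqP p b.
  move: mbn; rewrite -(subnK pb) !exprD jp jp' !mulr_algr -!scalerAr => mbn.
  by apply/graphZ/IH; lia.
exists (delta_mx (Ordinal mp) (Ordinal bp)); by rewrite symbol_comb_delta.
Qed.

Let graph_lreg (z : A) (z' : A') :
    (forall m b, graph (z * (i ^+ m * j ^+ b)) (z' * (i' ^+ m * j' ^+ b))) ->
  forall x x', graph x x' -> graph (z * x) (z' * x').
Proof.
move=> zG _ _ [M -> ->]; rewrite /symbol_comb !mulr_sumr.
apply: (big_ind2 graph graph0 graphD) => a _.
rewrite !mulr_sumr; apply: (big_ind2 graph graph0 graphD) => b _.
by rewrite -!scalerAr; apply: graphZ.
Qed.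

(** Moving [j] past i^m gives (i + 1)^m j^(b+1), whose binomial expansion has the same coefficients
    on both sides. *)
Let graph_mulj x x' : graph x x' -> graph (j * x) (j' * x').
Proof.
have [_ _ ji] := ij; have [_ _ ji'] := ij'.
apply: graph_lreg => m b.
have jX (B : falgType F) (u v : B) : v * u = (u + 1) * v ->
    v * (u ^+ m * v ^+ b) = \sum_(l < m.+1) 'C(m, l)%:R *: (u ^+ l * v ^+ b.+1).
  move=> vu; have -> : v * (u ^+ m * v ^+ b) = (u + 1) ^+ m * v ^+ b.+1.
    rewrite exprS !mulrA; congr (_ * _).
    elim: m => [|l IH]; first by rewrite mulr1 mul1r.
    by rewrite exprSr mulrA IH -mulrA vu mulrA -exprSr.
  rewrite addrC exprDn_comm; last exact/commr_sym/commr1.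
  rewrite mulr_suml; apply: eq_bigr => l _.
  by rewrite expr1n mul1r scaler_nat mulrnAl.
rewrite !jX //; apply: (big_ind2 graph graph0 graphD) => l _.
exact: graphZ.
Qed.

Let graph_muli x x' : graph x x' -> graph (i * x) (i' * x').
Proof.
by apply: graph_lreg => m b; rewrite !mulrA -!exprS; exact: graph_monomial.
Qed.

(** A monomial i^a j^b multiplies on the left by [j] and then by [i] repeatedly, and both operations
    preserve [graph]. So the two pairs share their structure constants. *)
Lemma symbol_graphM (M N : 'M[F]_p) : exists2 P : 'M[F]_p,
    symbol_comb i j M * symbol_comb i j N = symbol_comb i j P
  & symbol_comb i' j' M * symbol_comb i' j' N = symbol_comb i' j' P.
Proof.
have [P PE PE'] : graph (symbol_comb i j M * symbol_comb i j N)
    (symbol_comb i' j' M * symbol_comb i' j' N); last by exists P.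
have GN : graph (symbol_comb i j N) (symbol_comb i' j' N) by exists N.
rewrite {1 3}/symbol_comb !mulr_suml.
apply: (big_ind2 graph graph0 graphD) => a _.
rewrite !mulr_suml; apply: (big_ind2 graph graph0 graphD) => b _.
rewrite -!scalerAl; apply: graphZ; rewrite -!mulrA.
have {}GN : graph (j ^+ b * symbol_comb i j N) (j' ^+ b * symbol_comb i' j' N).
  elim: (b : nat) => [|m IH]; first by rewrite !mul1r.
  by rewrite !exprS -!mulrA; exact: graph_mulj.
elim: (a : nat) => [|m IH]; first by rewrite !mul1r.
by rewrite !exprS -!mulrA; exact: graph_muli.
Qed.

Lemma symbol_graph_monomial m b : exists2 P : 'M[F]_p,
  i ^+ m * j ^+ b = symbol_comb i j P & i' ^+ m * j' ^+ b = symbol_comb i' j' P.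
Proof. exact: graph_monomial. Qed.
End Graph.

(** The combinations form a subalgebra, by [symbol_graphM] for the pair and itself, and it contains
    [i] and [j]. *)
Lemma symbol_agenv (A : falgType F) (i j : A) :
    symbol_pair p alpha beta i j ->
  <<1 & [:: i; j]>>%VS = limg (linfun (symbol_comb (p := p) i j)).
Proof.
move=> ij; set V := limg _.
have VP x : reflect (exists M : 'M[F]_p, x = symbol_comb i j M) (x \in V).
  apply: (iffP memv_imgP) => [[M _ ->]|[M ->]].
    by exists M; rewrite lfunE.
  by exists M; rewrite ?memvf ?lfunE.
have monoV m b : i ^+ m * j ^+ b \in V.
  by have [M ME _] := symbol_graph_monomial ij ij m b; apply/VP; exists M.
have V1 : 1 \in V by have := monoV 0 0; rewrite mulr1.
have VM x y : x \in V -> y \in V -> x * y \in V.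
  move=> /VP[M ->] /VP[N ->]; apply/VP.
  by have [P PE _] := symbol_graphM ij ij M N; exists P.
have Vi : i \in V by have := monoV 1 0; rewrite mulr1.
have Vj : j \in V by have := monoV 0 1; rewrite mul1r.
apply/eqP; rewrite eqEsubv; apply/andP; split.
  apply: agenv_sub_modl; first by rewrite -memvE.
  apply/prodvP => x y xU yV; apply: VM => //; move: x xU; apply/subvP.
  rewrite subv_add -memvE V1; apply/span_subvP => x.
  by rewrite !inE => /orP[]/eqP->.
have gen x : x \in [:: i; j] -> x \in <<1 & [:: i; j]>>%VS.
  exact: seqv_sub_adjoin.
have genX x n : x \in [:: i; j] -> x ^+ n \in <<1 & [:: i; j]>>%VS.
  move=> /gen xr; elim: n => [|n IH]; first by rewrite memvE sub1_agenv.
  by rewrite exprS -agenvM memv_mul.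
apply/subvP => _ /VP[M ->]; rewrite /symbol_comb.
apply: memv_suml => a _; apply: memv_suml => b _; apply: memvZ.
by rewrite -agenvM memv_mul // genX // !inE eqxx ?orbT.
Qed.

Lemma symbol_agenv_dim (A : falgType F) (i j : A) :
  symbol_pair p alpha beta i j -> \dim <<1 & [:: i; j]>>%VS = (p ^ 2)%N.
Proof.
move=> ij; rewrite (symbol_agenv ij) limg_dim_eq ?dimvf /dim /= ?mulnn //.
apply/eqP; rewrite -subv0; apply/subvP => M; rewrite memv_cap memv_ker lfunE /=.
move=> /andP[_ /eqP M0]; rewrite memv0; apply/eqP/(symbol_comb_inj ij).
by rewrite M0 linear0.
Qed.

(** The subalgebra generated by a pair already has dimension p^2, so it fills an algebra of that
    dimension. *)
Lemma symbol_algebraP (A : falgType F) : symbol_algebra p alpha beta A <->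
  \dim {:A} = (p ^ 2)%N /\ exists i j : A, symbol_pair p alpha beta i j.
Proof.
split=> [[dimA [i [j [ip jp ju ji _]]]]|[dimA [i [j ij]]]]; split=> //.
  by exists i, j; split=> //; rewrite -ji divrK.
exists i, j; have ju := symbol_pair_unit ij.
have gen : <<1 & [:: i; j]>>%VS = {:A}%VS.
  by apply/eqP; rewrite eqEdim subvf dimA (symbol_agenv_dim ij) leqnn.
by case: ij => ip jp ji; split=> //; rewrite ji mulrK.
Qed.

(** Combinations with equal coefficients correspond: this is well defined by [symbol_comb_inj],
    defined everywhere by the dimension, and multiplicative by [symbol_graphM]. *)
Lemma symbol_algebra_iso (A A' : falgType F) :
    symbol_algebra p alpha beta A -> symbol_algebra p alpha beta A' ->
  alg_iso A A'.
Proof.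
case/symbol_algebraP=> dimA [i [j ij]] /symbol_algebraP[dimA' [i' [j' ij']]].
have onto (B : falgType F) (u v : B) : \dim {:B} = (p ^ 2)%N ->
    symbol_pair p alpha beta u v ->
    limg (linfun (symbol_comb (p := p) u v)) = fullv.
  move=> dimB uv; apply/eqP; rewrite eqEdim subvf dimB.
  by rewrite -(symbol_agenv uv) (symbol_agenv_dim uv) leqnn.
pose L := linfun (symbol_comb (p := p) i j).
pose phi (x : A) : A' := symbol_comb i' j' ((L^-1)%VF x).
have kerL : lker L == 0%VS.
  by apply/lker0P => M N; rewrite !lfunE => /(symbol_comb_inj ij).
have phiE (M : 'M[F]_p) : phi (symbol_comb i j M) = symbol_comb i' j' M.
  have <- : L M = symbol_comb i j M by rewrite lfunE.
  by rewrite /phi lker0_lfunK.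
have AP x : exists M : 'M[F]_p, x = symbol_comb i j M.
  have : x \in limg L by rewrite onto ?memvf.
  by case/memv_imgP => M _ ->; exists M; rewrite lfunE.
apply: (@alg_iso_surj _ _ _ phi).
- by move=> c x y; rewrite /phi !linearP.
- have [M ME ME'] := symbol_graph_monomial ij ij' 0 0.
  by move: ME ME'; rewrite !expr0 !mulr1 => -> ->; rewrite phiE.
- move=> x y; have [M ->] := AP x; have [N ->] := AP y.
  by have [P PE PE'] := symbol_graphM ij ij' M N; rewrite PE !phiE PE'.
- by rewrite dimA.
move=> y; have : y \in limg (linfun (symbol_comb (p := p) i' j')).
  by rewrite onto ?memvf.
by case/memv_imgP => M _ ->; exists (symbol_comb i j M); rewrite phiE lfunE.
Qed.

(** Existence of [alpha, beta) is thereby reduced to finding a pair in an algebra of any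
    dimension. *)
Lemma symbol_subalgebra (T : falgType F) (i j : T) :
  symbol_pair p alpha beta i j ->
  exists A : falgType F, symbol_algebra p alpha beta A.
Proof.
move=> ij; pose U := <<1 & [:: i; j]>>%AS; exists (subvs_of U).
have U1 : 1 \in U by rewrite memvE; exact: sub1_agenv.
have Ui : i \in U by apply: seqv_sub_adjoin; rewrite !inE eqxx.
have Uj : j \in U by apply: seqv_sub_adjoin; rewrite !inE eqxx orbT.
(* The unit of [subvs_of U] is [algid U], which equals 1 because [U] contains 1. *)
have a1 : algid <<1 & [:: i; j]>>%AS = 1 by apply/eqP; rewrite algid_eq1.
have vX (x : subvs_of U) n : vsval (x ^+ n) = vsval x ^+ n.
  by elim: n => // n IH; rewrite !exprS -IH.
apply/symbol_algebraP; split; first by rewrite dimvf -(symbol_agenv_dim ij).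
have [ip jp ji] := ij.
exists (Subvs Ui), (Subvs Uj); split; apply: val_inj => /=.
- by rewrite vX /= a1.
- by rewrite vX /= a1.
- by rewrite a1.
Qed.
End SymbolPair.

Lemma symbol_algebra_shift (F : fieldType) p (alpha beta x : F)
    (A : falgType F) :
    p \in [pchar F] -> beta != 0 -> symbol_algebra p alpha beta A ->
  symbol_algebra p (alpha + (x ^+ p - x)) beta A.
Proof.
move=> charF beta0 /(symbol_algebraP _ charF beta0)[dimA [i [j ij]]].
apply/symbol_algebraP => //; split=> //.
by exists (i + x%:A), j; apply: symbol_pair_shift.
Qed.

(** Cayley-Hamilton for the companion matrix, cast from size [(size q).-1]. The entries serve to
    check a commutation with a diagonal matrix later. *)
Lemma companionmx_root (R : comNzRingType) n (q : {poly R}) :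
    q \is monic -> size q = n.+2 ->
  exists X : 'M[R]_n.+1, horner_mx X q = 0 /\ forall a b : 'I_n.+1,
    X a b = if a == n :> nat then - q`_b else (a.+1 == b :> nat)%:R.
Proof.
move=> monq sq; have e : (size q).-1 = n.+1 by rewrite sq.
exists (castmx (e, e) (companionmx q)); split=> [|a b]; last first.
  by rewrite castmxE mxE /= sq.
have Eq : char_poly (castmx (e, e) (companionmx q)) = q.
  rewrite -[RHS](companionmxK monq).
  by move: (companionmx q); case: _ / e => M; rewrite castmx_id.
by rewrite -[X in horner_mx _ X]Eq Cayley_Hamilton.
Qed.

(* In M_p (x) M_p take i = X (x) 1 + 1 (x) D and j = 1 (x) Y, where X and Y are
   the companion matrices of x^p - x - alpha and x^p - beta, and D is the
   diagonal matrix of 0, ..., p - 1, so that Y D = (D + 1) Y. *)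
Lemma symbol_algebra_ex (F : fieldType) p (alpha beta : F) :
    p \in [pchar F] -> beta != 0 ->
  exists A : falgType F, symbol_algebra p alpha beta A.
Proof.
move=> charF beta0; have p_pr := pcharf_prime charF.
case: p p_pr charF => [|[|n]] // p_pr charF; set p := n.+2.
have sl c : (size (c : {poly F}) < p.+1)%N -> size ('X^p + c) = p.+1.
  by move=> sc; rewrite size_polyDl size_polyXn.
have mon c : (size (c : {poly F}) < p.+1)%N -> 'X^p + c \is monic.
  by move=> sc; rewrite monicE lead_coefDl ?lead_coefXn ?size_polyXn.
have s1 : (size (- 'X - alpha%:P : {poly F})%R < p.+1)%N.
  by rewrite -opprD size_polyN size_XaddC.
have s2 : (size (- beta%:P : {poly F})%R < p.+1)%N.
  by rewrite size_polyN (leq_ltn_trans (size_polyC_leq1 _)).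
have [X [Xq _]] := companionmx_root (mon _ s1) (sl _ s1).
have [Y [Yq YE]] := companionmx_root (mon _ s2) (sl _ s2).
pose D : 'M[F]_p := diag_mx (\row_a (a : nat)%:R).
(* Frobenius fixes the diagonal entries, which lie in the prime field. *)
have Dp : D ^+ p = D.
  have -> m : D ^+ m = diag_mx (\row_a (a : nat)%:R ^+ m).
    elim: m => [|m IH].
      by apply/matrixP => a b; rewrite !mxE expr0.
    rewrite exprS IH -[_ * _]/(_ *m _) mulmx_diag; congr diag_mx.
    by apply/rowP => a; rewrite !mxE exprS.
  congr diag_mx; apply/rowP => a; rewrite !mxE.
  by rewrite -(pFrobenius_autE charF) pFrobenius_aut_nat.
have YD : Y * D = (D + 1) * Y.
  rewrite mulrDl mul1r -![_ * _]/(_ *m _) /D mul_mx_diag mul_diag_mx.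
  apply/matrixP => a b; rewrite !mxE YE.
  case: eqP => [an|_].
    (* The last row has its only nonzero entry, beta, in column 0, where the identity holds because
       0 = (p - 1) + 1 in [F]. *)
    rewrite coefD coefXn coefN coefC ltn_eqF // add0r opprK an.
    case: eqP => [->|_]; last by rewrite !(mulr0, mul0r) addr0.
    by rewrite mulr0 -[X in _ + X]mul1r -mulrDl natr1 (pcharf0 charF) mul0r.
  case: eqP => [<-|_]; last by rewrite !(mulr0, mul0r) addr0.
  by rewrite mulr1 mul1r -natr1.
have Xp : X ^+ p - X = alpha%:A.
  move/eqP: Xq; rewrite !(rmorphD, rmorphB, rmorphN) rmorphXn /= horner_mx_X.
  by rewrite horner_mx_C addrA subr_eq0 scalemx1 => /eqP.
have Yp : Y ^+ p = beta%:A.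
  move/eqP: Yq; rewrite !(rmorphD, rmorphN) rmorphXn /= horner_mx_X.
  by rewrite horner_mx_C subr_eq0 scalemx1 => /eqP.
pose M : falgType F := 'M[F]_p.
have charT : p \in [pchar tensor M M] by rewrite pchar_lalg.
apply: (@symbol_subalgebra F p alpha beta charF beta0 (tensor M M)
  (tensl M (X : M) + tensr M (D : M)) (tensr M (Y : M))).
have XD : GRing.comm (tensl M (X : M)) (tensr M (D : M)) by exact: tenslrC.
split.
- rewrite -(pFrobenius_autE charT) pFrobenius_autD_comm //= !pFrobenius_autE.
  rewrite -!rmorphXn Dp /= opprD addrACA subrr addr0 -rmorphB Xp.
  by rewrite /= linearZ /= rmorph1.
- have -> : tensr M (Y : M) ^+ p = tensr M ((Y : M) ^+ p) by rewrite rmorphXn.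
  by rewrite [(Y : M) ^+ p]Yp linearZ /= rmorph1.
rewrite mulrDl mul1r mulrDr mulrDl -tenslrC -addrA; congr (_ + _).
by rewrite -!rmorphM YD mulrDl mul1r rmorphD.
Qed.

(** * Descent *)

Lemma big_tensor_alg_iso (F : fieldType) n (C C' : 'I_n -> falgType F) :
  (forall i, alg_iso (C i) (C' i)) ->
  alg_iso (\big[@tensor F/(F^o : falgType F)]_(i < n) C i)
          (\big[@tensor F/(F^o : falgType F)]_(i < n) C' i).
Proof.
elim: n C C' => [|n IH] C C' CC'.
  by rewrite !big_ord0; exact: alg_iso_refl.
by rewrite !big_ord_recl; apply: tensor_alg_iso => //; apply: IH.
Qed.

Lemma alg_iso_central_simple (F : fieldType) (A B : falgType F) :
  alg_iso A B -> central_simple A -> central_simple B.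
Proof.
move=> isoAB [/centerP ZA simA]; have dimAB := alg_iso_dim isoAB.
case: isoAB => phi [psi phiK psiK]; split.
  apply/centerP => b bC; have [a|c psib] := ZA (psi b).
    by apply: (can_inj phiK); rewrite !rmorphM /= !psiK.
  by exists c; rewrite -(psiK b) psib linearZ rmorph1.
move=> I /prodvP lI /prodvP rI; pose L := linfun phi; pose J := (L @^-1: I)%VS.
have JP a : (a \in J) = (phi a \in I) by rewrite -memv_preim lfunE.
have IJ : (L @: J)%VS = I.
  apply/eqP; rewrite eqEsubv; apply/andP; split; apply/subvP => b.
    by case/memv_imgP => a; rewrite JP => aI ->; rewrite lfunE.
  by move=> bI; rewrite -(psiK b) -[phi _](lfunE phi) memv_img // JP psiK.
have fullL : (L @: {:A})%VS = {:B}%VS.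
  apply/eqP; rewrite eqEsubv subvf; apply/subvP => b _.
  by rewrite -(psiK b) -[phi _](lfunE phi) memv_img ?memvf.
have [||J0|J1] := simA J; last 2 first.
- by left; rewrite -IJ J0 limg0.
- by right; rewrite -IJ J1.
- by apply/prodvP => x y _; rewrite !JP rmorphM => ?; apply: lI; rewrite ?memvf.
- by apply/prodvP => x y; rewrite !JP rmorphM => ? _; apply: rI; rewrite ?memvf.
Qed.

Section Descent.
Variables (E F : fieldType) (f : {rmorphism E -> F}) (A : falgType E).

(** Some coordinate of 1 is nonzero, and comparing it on both sides shows that [c] lies in f(E). *)
Lemma ext_in_scalar (a : A) (c : F) :
  ext_in f a = c%:A -> exists e : E, a = e%:A.
Proof.
move=> ac; have acE l : f (acoord l a) = c * f (acoord l (1 : A)).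
  have := congr1 (fun w => tcomp w l) ac.
  rewrite tcompZ -[1 : scalar_ext f A]tens1 /ext_in !tcomp_tens.
  by rewrite ![_ *: 1]mulr1.
have [l l0] : exists l, acoord l (1 : A) != 0.
  apply: NNPP => nz; have /eqP[] := oner_neq0 A.
  rewrite (acoord_sum 1) big1 // => l _.
  have [->|l0] := eqVneq (acoord l (1 : A)) 0; first by rewrite scale0r.
  by case: nz; exists l.
have [e cE] : exists e, c = f e.
  exists (acoord l a / acoord l (1 : A)).
  by rewrite fmorph_div acE mulfK ?fmorph_eq0.
exists e; rewrite [LHS]acoord_sum [in RHS](acoord_sum 1) scaler_sumr.
apply: eq_bigr => m _; rewrite scalerA; congr (_ *: _).
by apply: (fmorph_inj f); rewrite rmorphM /= -cE acE.
Qed.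

Lemma ext_in_inj : injective (@ext_in E F f A).
Proof.
move=> a b ab; rewrite (acoord_sum a) (acoord_sum b); apply: eq_bigr => l _.
congr (_ *: _); apply: (fmorph_inj f).
have := congr1 (fun w => tcomp w l) ab.
by rewrite /ext_in !tcomp_tens ![_ *: 1]mulr1.
Qed.

(** A central element of [A] stays central in the extension, hence is a scalar, from [E] by
    [ext_in_scalar]. An ideal [I] spans an ideal [J] of the extension: J = 0 forces I = 0 since [A]
    embeds, and if [J] is everything then dim I >= dim A. *)
Lemma central_simple_descent :
  central_simple (scalar_ext f A) -> central_simple A.
Proof.
case=> /centerP Z simple; split.
  apply/centerP => a aC; have [|c ac] := Z (ext_in f a).
    apply: scalar_ext_ind => [u v Hu Hv|x b].
      by rewrite mulrDl mulrDr Hu Hv.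
    by rewrite -scalerAl -scalerAr -!rmorphM /= aC.
  exact: ext_in_scalar ac.
move=> I /prodvP lI /prodvP rI.
pose J := <<[seq ext_in f a | a <- vbasis I]>>%VS.
have memJ a : a \in I -> ext_in f a \in J.
  move=> /coord_vbasis ->; rewrite rmorph_sum; apply: memv_suml => l _ /=.
  rewrite ext_inZ; apply/memvZ/memv_span/map_f/mem_nth.
  by rewrite size_tuple.
have Jind (P : scalar_ext f A -> Prop) :
    P 0 -> (forall u v, P u -> P v -> P (u + v)) ->
    (forall x a, a \in I -> P (x *: ext_in f a)) -> forall u, u \in J -> P u.
  move=> P0 PD PI u /(@coord_span _ _ _ (in_tuple _)) ->.
  apply: big_ind => // l _.
  have : (in_tuple [seq ext_in f a | a <- vbasis I])`_l
      \in [seq ext_in f a | a <- vbasis I] by exact/mem_nth/ltn_ord.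
  by case/mapP => a /vbasis_mem aI ->; exact: PI.
have [||J0|J1] := simple J.
- apply/prodvP => u v _ Jv; move: v Jv u; apply: Jind => [u|v w Jv Jw u|x a aI].
  + by rewrite mulr0 mem0v.
  + by rewrite mulrDr memvD.
  apply: scalar_ext_ind => [u v Hu Hv|y b]; first by rewrite mulrDl memvD.
  by rewrite -scalerAl -scalerAr -rmorphM /= !memvZ // memJ // lI ?memvf.
- apply/prodvP => u v Ju _; move: u Ju v; apply: Jind => [v|u w Ju Jw v|x a aI].
  + by rewrite mul0r mem0v.
  + by rewrite mulrDl memvD.
  apply: scalar_ext_ind => [u v Hu Hv|y b]; first by rewrite mulrDr memvD.
  by rewrite -scalerAl -scalerAr -rmorphM /= !memvZ // memJ // rI ?memvf.
- left; apply/eqP; rewrite -subv0; apply/subvP => a /memJ; rewrite J0 !memv0.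
  by move=> /eqP a0; apply/eqP/ext_in_inj; rewrite rmorph0.
right; apply/eqP; rewrite eqEdim subvf /= -(dim_scalar_ext f A) -J1.
by rewrite (leq_trans (dim_span _)) // size_map size_tuple.
Qed.
End Descent.

(** * The bound on the essential dimension *)

Lemma nat_least (P : nat -> Prop) m : P m ->
  exists2 n, P n /\ (forall l, P l -> (n <= l)%N) & (n <= m)%N.
Proof.
elim/ltn_ind: m => m IH Pm.
have [[l lm Pl]|nP] := classic (exists2 l, (l < m)%N & P l).
  have [n nP nl] := IH l lm Pl; exists n => //; exact: leq_trans nl (ltnW lm).
exists m => //; split=> // l Pl; rewrite leqNgt; apply/negP => lm.
by apply: nP; exists l.
Qed.

Lemma decomposable_descends (k : closedFieldType) (p n : nat) (F : fieldType)
    (iF : {rmorphism k -> F}) (A : ff_obj (Dec k p n) iF) :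
  p \in [pchar k] -> exists2 d, descends_to A d & (d <= n.+1)%N.
Proof.
move=> chark; case: A => A [csA dimA [C cycC isoA]].
have charF : p \in [pchar F] by rewrite (fmorph_pchar iF).
have symC i : exists ab : F * F, ab.2 != 0 /\ symbol_algebra p ab.1 ab.2 (C i).
  by have [a [b ab]] := cycC i; exists (a, b).
pose ab i := sval (constructive_indefinite_description _ (symC i)).
pose alpha i := (ab i).1; pose beta i := (ab i).2.
have beta0 i : beta i != 0.
  by case: (svalP (constructive_indefinite_description _ (symC i))).
have Csym i : symbol_algebra p (alpha i) (beta i) (C i).
  by case: (svalP (constructive_indefinite_description _ (symC i))).
have [c [t ct]] := artin_schreier_common_multiple iF alpha chark.
(* The n + 1 elements: t first, then the beta_j. *)
pose g (i : 'I_n.+1) := if unlift ord0 i is Some j then beta j else t.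
have [d [s [dn inds alg_s]]] := transcendence_basis_sub iF g.
have [E [v vP]] := subfield_field (algebraic_closure iF s).
have {}vP x : algebraic_over iF s x <-> exists y, v y = x.
  by rewrite -vP; apply: iff_sym; exact: algebraic_closureE.
have [|iE vE] := @rmorphism_lift k E F iF v.
  move=> a; apply/vP/in_adjoin_algebraic.
  by exists a%:MP, 1; rewrite rmorph1 divr1 mmapC.
have [t' tE] : exists y, v y = t.
  by apply/vP; have := alg_s ord0; rewrite /g unlift_none.
have betaE i : exists y, v y = beta i.
  by apply/vP; have := alg_s (lift ord0 i); rewrite /g liftK.
pose beta' i := sval (constructive_indefinite_description _ (betaE i)).
have vbeta' i : v (beta' i) = beta i.
  exact: svalP (constructive_indefinite_description _ (betaE i)).
have beta'0 i : beta' i != 0 by rewrite -(fmorph_eq0 v) vbeta'.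
have Bex i : exists B : falgType E,
    symbol_algebra p (iE (c i) * t') (beta' i) B.
  by apply: symbol_algebra_ex; rewrite // -(fmorph_pchar v).
pose B i := sval (constructive_indefinite_description _ (Bex i)).
have Bsym i : symbol_algebra p (iE (c i) * t') (beta' i) (B i).
  exact: svalP (constructive_indefinite_description _ (Bex i)).
pose T : falgType E := \big[@tensor E/(E^o : falgType E)]_(i < n) B i.
have BC i : alg_iso (scalar_ext v (B i)) (C i).
  have := scalar_ext_symbol v (Bsym i).
  rewrite rmorphM tE [v (iE _)]vE vbeta'.
  move=> symB; apply: (symbol_algebra_iso charF (beta0 i) symB).
  (* As c_i t = alpha_i + (x^p - x), the algebra [C i] is also a symbol algebra for c_i t. *)
  have [x xE] := ct i; rewrite -[iF (c i) * t](subrK (alpha i)) addrC xE.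
  exact: symbol_algebra_shift.
have isoT : alg_iso (scalar_ext v T) A.
  apply: alg_iso_trans (scalar_ext_big_tensor v B) _.
  apply: alg_iso_trans (big_tensor_alg_iso BC) _.
  exact: alg_iso_sym.
have decT : decomposable p n T.
  split.
  (* Central simplicity of [T] is read off from [A], its scalar extension up to isomorphism. *)
  - apply: (@central_simple_descent _ _ v).
    exact: alg_iso_central_simple (alg_iso_sym isoT) csA.
  - by rewrite -dimA -(alg_iso_dim isoT) dim_scalar_ext.
  exists B; last exact: alg_iso_refl.
  by move=> i; exists (iE (c i) * t'), (beta' i).
exists d => //; exists E, iE, v, vE, (exist _ T decT); split; last exact: isoT.
exact: algebraic_closure_trdeg vE inds vP.
Qed.

Theorem proposition9p1 (k : closedFieldType) (p n : nat)
    (p_prime : prime p) (char_k : p \in [pchar k]) (n_gt0 : (0 < n)%N) :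
  exists2 e : nat, is_ed (Dec k p n) e & (e <= n.+1)%N.
Proof.
(* The supremum is the least upper bound, and n + 1 is an upper bound; likewise each ed(A) is the
   least element of a nonempty set of natural numbers. *)
apply: nat_least => F iF A; have [d dA dn] := decomposable_descends A char_k.
have [e eP ed] := nat_least dA.
by exists e => //; exact: leq_trans ed dn.
Qed.
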